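(* Let $(M,g)$ be a smooth Riemannian manifold of dimension $n\geq 3$ and $f\in C^\infty(M)$. The following conditions are equivalent: (a) $\mathrm{div}(e^{-f}\mathrm{Riem})=0$; (b) the Bakry–Emery Ricci tensor $\mathrm{Ric}_f=\mathrm{Ric}+\nabla^2 f$ is a Codazzi tensor, i.e. $(\mathrm{Ric}_f)_{ij,k}=(\mathrm{Ric}_f)_{ik,j}$; (c) $(M,g,f)$ satisfies $$C_{ijk}+f_tW_{tijk}=D^{\nabla f}_{ijk}\quad\text{and}\quad R_i=2f_tR_{ti}.$$
   Context: Components are with respect to a local orthonormal frame, repeated indices are summed, and indices after a comma denote covariant derivatives; $f_i=\nabla_i f$, $R_i=\nabla_iR$. With $\mathrm{R}(X,Y)Z=\nabla_X\nabla_YZ-\nabla_Y\nabla_XZ-\nabla_{[X,Y]}Z$, the $(0,4)$ tensor $\mathrm{Riem}$ has components $R_{ijkl}=g(\mathrm{R}(e_k,e_l)e_j,e_i)$; $R_{ik}=R_{ijkj}$ are the components of $\mathrm{Ric}$ and $R=R_{ii}$ is the scalar curvature. $\mathrm{div}(e^{-f}\mathrm{Riem})_{jkl}=(e^{-f}R_{ijkl})_{,i}$. The Weyl tensor is $$W_{ijkl}=R_{ijkl}-\tfrac{1}{n-2}(R_{ik}\delta_{jl}-R_{il}\delta_{jk}+R_{jl}\delta_{ik}-R_{jk}\delta_{il})+\tfrac{R}{(n-1)(n-2)}(\delta_{ik}\delta_{jl}-\delta_{il}\delta_{jk}),$$ the Cotton tensor is $$C_{ijk}=R_{ij,k}-R_{ik,j}-\tfrac{1}{2(n-1)}(R_k\delta_{ij}-R_j\delta_{ik}),$$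 and $$D^{\nabla f}_{ijk}=\tfrac{1}{n-2}(f_kR_{ij}-f_jR_{ik})+\tfrac{1}{(n-1)(n-2)}f_t(R_{tk}\delta_{ij}-R_{tj}\delta_{ik})-\tfrac{R}{(n-1)(n-2)}(f_k\delta_{ij}-f_j\delta_{ik}).$$ *)

(* Defs.v *)
From HB Require Import structures.
From mathcomp Require Import all_boot all_order all_algebra.
From mathcomp Require Import all_classical all_reals all_analysis.
From mathcomp Require Import ring.

Set Implicit Arguments.
Unset Strict Implicit.
Unset Printing Implicit Defensive.

Import Order.TTheory GRing.Theory Num.Theory.
Import numFieldNormedType.Exports.

Local Open Scope classical_set_scope.
Local Open Scope ring_scope.

(** Functions are total; only their values on the open set under consideration
    matter (directional derivatives at a point depend on germs only). *)

Section Smooth.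
Variables (R : realType) (n : nat).
Implicit Types (U : set 'rV[R]_n) (F : 'rV[R]_n -> R).

Definition partial (i : 'I_n) F : 'rV[R]_n -> R :=
  fun x => 'D_(delta_mx 0 i) F x.

Fixpoint Ck_on (k : nat) U F : Prop :=
  (forall x, U x -> {for x, continuous F}) /\
  match k with
  | 0%N => True
  | k'.+1 => forall i : 'I_n,
      (forall x, U x -> derivable F x (delta_mx 0 i)) /\
      Ck_on k' U (partial i F)
  end.

Definition smooth_on U F : Prop := forall k, Ck_on k U F.

Definition smooth_map_on m U (h : 'rV[R]_n -> 'rV[R]_m) : Prop :=
  forall j, smooth_on U (fun x => h x 0 j).

End Smooth.

Record chart (R : realType) (n : nat) (M : topologicalType) := Chart {
  cdom : set M;
  cmap : M -> 'rV[R]_n;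
  cinv : 'rV[R]_n -> M;
  cdom_open : open cdom;
  cimage_open : open (cmap @` cdom);
  cmapK : forall p, cdom p -> cinv (cmap p) = p;
  cmap_continuous : {within cdom, continuous cmap};
  cinv_continuous : {within cmap @` cdom, continuous cinv} }.

Definition cimage (R : realType) (n : nat) (M : topologicalType)
  (phi : chart R n M) : set 'rV[R]_n := cmap phi @` cdom phi.

Definition transition (R : realType) (n : nat) (M : topologicalType)
  (phi psi : chart R n M) : 'rV[R]_n -> 'rV[R]_n := cmap psi \o cinv phi.

(* The atlas is not required to be maximal: any atlas determines the smooth
   structure, and a maximal atlas is a particular case. *)
Record smoothManifold (R : realType) (n : nat) := SmoothManifold {
  carrier :> topologicalType;
  manifold_hausdorff : hausdorff_space carrier;
  manifold_second_countable : @second_countable carrier;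
  atlas : set (chart R n carrier);
  atlas_cover : forall p : carrier, exists2 phi, atlas phi & cdom phi p;
  atlas_smooth : forall phi psi, atlas phi -> atlas psi ->
    smooth_map_on (cmap phi @` (cdom phi `&` cdom psi)) (transition phi psi) }.

Definition smooth_function (R : realType) (n : nat) (M : smoothManifold R n)
  (f : M -> R) : Prop :=
  forall phi, atlas phi -> smooth_on (cimage phi) (f \o cinv phi).

(* [gram phi x] is the matrix (g(d_i, d_j)) of the metric in the chart [phi] at
   the point of coordinates [x]. Vectors are rows and
   ['D_v h x = v *m jacobian h x], hence the shape of [gram_transition], which
   says that the matrices [gram phi] glue to a (0,2) tensor on [M]. *)
Record riemannianMetric (R : realType) (n : nat) (M : smoothManifold R n) :=
  RiemannianMetric {
  gram : chart R n M -> 'rV[R]_n -> 'M[R]_n;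
  gram_smooth : forall phi, atlas phi ->
    forall i j, smooth_on (cimage phi) (fun x => gram phi x i j);
  gram_sym : forall phi, atlas phi ->
    forall x, cimage phi x -> (gram phi x)^T = gram phi x;
  gram_posdef : forall phi, atlas phi -> forall x, cimage phi x ->
    forall v : 'rV[R]_n, v != 0 -> 0 < (v *m gram phi x *m v^T) 0 0;
  gram_transition : forall phi psi, atlas phi -> atlas psi ->
    forall p : M, cdom phi p -> cdom psi p ->
    let J := jacobian (transition phi psi) (cmap phi p) in
    gram phi (cmap phi p) = J *m gram psi (cmap psi p) *m J^T }.

Section Local.
Variables (R : realType) (n : nat).

Definition sfield := 'rV[R]_n -> R.
Definition vfield := 'rV[R]_n -> 'rV[R]_n.

(* Covariant tensor fields, as functions of vector fields. *)
Definition tensor2 := vfield -> vfield -> sfield.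
Definition tensor4 := vfield -> vfield -> vfield -> vfield -> sfield.

Definition along (X : vfield) (F : sfield) : sfield := fun x => 'D_(X x) F x.

Definition vcomp (X : vfield) (k : 'I_n) : sfield := fun x => X x 0 k.

Definition lie_bracket (X Y : vfield) : vfield :=
  fun x => \row_k (along X (vcomp Y k) x - along Y (vcomp X k) x).

Variable G : 'rV[R]_n -> 'M[R]_n.

Definition inner (X Y : vfield) : sfield :=
  fun x => (X x *m G x *m (Y x)^T) 0 0.

(* Christoffel symbols Gamma^k_ij of the Levi-Civita connection; see
   [nabla_torsion_free] and [nabla_metric] below. *)
Definition christoffel (k i j : 'I_n) : sfield := fun x =>
  2^-1 * \sum_l invmx (G x) k l *
    (partial i (fun y => G y j l) x + partial j (fun y => G y i l) x
     - partial l (fun y => G y i j) x).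

Definition nabla (X Y : vfield) : vfield := fun x =>
  \row_k (along X (vcomp Y k) x
          + \sum_i \sum_j christoffel k i j x * X x 0 i * Y x 0 j).

Definition curvature (X Y Z : vfield) : vfield := fun x =>
  nabla X (nabla Y Z) x - nabla Y (nabla X Z) x - nabla (lie_bracket X Y) Z x.

(* R_ijkl = g(R(e_k, e_l) e_j, e_i) *)
Definition Riem : tensor4 := fun A B C D => inner (curvature C D B) A.

Definition hessian (F : sfield) : tensor2 := fun X Y x =>
  along X (along Y F) x - along (nabla X Y) F x.

(* Covariant derivatives of tensors; the direction of derivation comes first,
   so that T_ij,k = cov2 T (e_k) (e_i) (e_j). *)
Definition cov2 (T : tensor2) (Z X Y : vfield) : sfield := fun x =>
  along Z (T X Y) x - T (nabla Z X) Y x - T X (nabla Z Y) x.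

Definition cov4 (T : tensor4) (Z A B C D : vfield) : sfield := fun x =>
  along Z (T A B C D) x
  - T (nabla Z A) B C D x - T A (nabla Z B) C D x
  - T A B (nabla Z C) D x - T A B C (nabla Z D) x.

Definition orthonormal_frame (U : set 'rV[R]_n) (E : 'I_n -> vfield) : Prop :=
  (forall i, smooth_map_on U (E i)) /\
  (forall x, U x -> forall i j, inner (E i) (E j) x = (i == j)%:R).

(* From here on everything is computed in an orthonormal frame [E], where traces
   are plain sums. *)

Variable E : 'I_n -> vfield.

Definition Ric : tensor2 := fun X Y x => \sum_j Riem X (E j) Y (E j) x.

Definition scal : sfield := fun x => \sum_i Ric (E i) (E i) x.

Variable F : sfield.

Definition Ric_f : tensor2 := fun X Y x => Ric X Y x + hessian F X Y x.

(* div(e^{-f} Riem)_jkl = (e^{-f} R_ijkl)_,i *)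
Definition div_exp_Riem (j k l : 'I_n) : sfield := fun x =>
  \sum_i cov4 (fun A B C D y => expR (- F y) * Riem A B C D y)
    (E i) (E i) (E j) (E k) (E l) x.

Local Notation d i j := ((i == j)%:R : R).
Local Notation Rm i j k l x := (Riem (E i) (E j) (E k) (E l) x).
Local Notation Rc i j x := (Ric (E i) (E j) x).
Local Notation Rc' i j k x := (cov2 Ric (E k) (E i) (E j) x).
Local Notation dR i x := (along (E i) scal x).
Local Notation dF i x := (along (E i) F x).
Local Notation n1 := (n%:R - 1 : R).
Local Notation n2 := (n%:R - 2 : R).

Definition Weyl (i j k l : 'I_n) : sfield := fun x =>
  Rm i j k l x
  - n2^-1 * (Rc i k x * d j l - Rc i l x * d j k
             + Rc j l x * d i k - Rc j k x * d i l)
  + scal x / (n1 * n2) * (d i k * d j l - d i l * d j k).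

Definition Cotton (i j k : 'I_n) : sfield := fun x =>
  Rc' i j k x - Rc' i k j x
  - (2 * n1)^-1 * (dR k x * d i j - dR j x * d i k).

Definition Dtensor (i j k : 'I_n) : sfield := fun x =>
  n2^-1 * (dF k x * Rc i j x - dF j x * Rc i k x)
  + (n1 * n2)^-1 *
    \sum_t dF t x * (Rc t k x * d i j - Rc t j x * d i k)
  - scal x / (n1 * n2) * (dF k x * d i j - dF j x * d i k).

Definition div_zero_at (x : 'rV[R]_n) : Prop :=
  forall j k l, div_exp_Riem j k l x = 0.

Definition codazzi_at (x : 'rV[R]_n) : Prop :=
  forall i j k, cov2 Ric_f (E k) (E i) (E j) x = cov2 Ric_f (E j) (E i) (E k) x.

Definition cotton_weyl_at (x : 'rV[R]_n) : Prop :=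
  (forall i j k,
    Cotton i j k x + \sum_t dF t x * Weyl t i j k x = Dtensor i j k x) /\
  (forall i, dR i x = 2 * \sum_t dF t x * Rc t i x).

End Local.

(** [nabla] is the Levi-Civita connection: it is torsion-free and metric. *)

Section LeviCivita.
Variables (R : realType) (n : nat) (G : 'rV[R]_n -> 'M[R]_n) (x : 'rV[R]_n).
Hypothesis G_sym : \forall y \near x, (G y)^T = G y.

Let partial_sym i j k :
  partial i (fun y => G y j k) x = partial i (fun y => G y k j) x.
Proof.
apply: near_eq_derive; near do by rewrite -[in LHS](near G_sym _ _) ?mxE //.
Unshelve. all: by end_near. Qed.

Lemma nabla_torsion_free (X Y : vfield R n) :
  nabla G X Y x - nabla G Y X x = lie_bracket X Y x.
Proof.
apply/rowP => k; rewrite !mxE opprD addrACA.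
rewrite [X in _ + (X - _)]exchange_big/=.
set A := (X in _ + (X - _)); set B := (X in _ + (_ - X)).
suff -> : A = B by rewrite subrr addr0.
apply: eq_bigr => i _; apply: eq_bigr => j _.
rewrite mulrAC; congr (_ * _ * _); congr (_ * _); apply: eq_bigr => l _.
by rewrite (partial_sym l i j) (addrC (partial i _ _)).
Qed.

Lemma nabla_metric (X Y Z : vfield R n) :
  G x \in unitmx ->
  (forall i j, differentiable (fun y => G y i j) x) ->
  (forall i, differentiable (vcomp Y i) x) ->
  (forall i, differentiable (vcomp Z i) x) ->
  along X (inner G Y Z) x =
    inner G (nabla G X Y) Z x + inner G Y (nabla G X Z) x.
Proof.
move=> Gu dG dY dZ.
have innerE (A B : vfield R n) y :
    inner G A B y = \sum_i \sum_j A y 0 i * G y i j * B y 0 j.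
  rewrite /inner mxE exchange_big/=; apply: eq_bigr => j _.
  by rewrite !mxE mulr_suml.
pose dX (F : sfield R n) := 'D_(X x) F x.
have dXG i j : dX (fun y => G y i j) =
    \sum_a X x 0 a * partial a (fun y => G y i j) x.
  rewrite /dX deriveE// {1}(row_sum_delta (X x)) linear_sum/=.
  by apply: eq_bigr => a _; rewrite linearZ/= -deriveE.
have derYGZ : dX (inner G Y Z) = \sum_i \sum_j
   (dX (vcomp Y i) * G x i j * Z x 0 j
    + Y x 0 i * dX (fun y => G y i j) * Z x 0 j
    + Y x 0 i * G x i j * dX (vcomp Z j)).
  have -> : inner G Y Z =
      \sum_i \sum_j ((vcomp Y i * (fun y => G y i j)) * vcomp Z j).
    apply/funext => y; rewrite innerE fct_sumE; apply: eq_bigr => i _.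
    by rewrite fct_sumE.
  have dv (F : 'rV[R]_n -> R) : differentiable F x -> derivable F x (X x).
    exact: diff_derivable.
  have d1 i j : derivable (vcomp Y i * (fun y => G y i j)) x (X x).
    by apply: derivableM; exact: dv.
  have d2 i j : derivable (vcomp Y i * (fun y => G y i j) * vcomp Z j) x (X x).
    by apply: derivableM => //; exact: dv.
  rewrite /dX derive_sum; last by move=> i; apply: derivable_sum.
  apply: eq_bigr => i _; rewrite derive_sum//; apply: eq_bigr => j _.
  rewrite deriveM//; last exact: dv.
  rewrite deriveM; [|exact: dv|exact: dv].
  rewrite /GRing.scale/= /vcomp; rewrite -[(_ * _) x]/(_ x * _ x)/=; ring.
have lower a b j : \sum_i christoffel G i a b x * G x i j =
    2^-1 * (partial a (fun y => G y b j) x + partial b (fun y => G y a j) x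
            - partial j (fun y => G y a b) x).
  set L := fun l => partial a (fun y => G y b l) x +
     partial b (fun y => G y a l) x - partial l (fun y => G y a b) x.
  transitivity (2^-1 * \sum_l (\sum_i invmx (G x) l i * G x i j) * L l).
    rewrite /christoffel -/L.
    under eq_bigr do rewrite -mulrA mulr_suml.
    rewrite -mulr_sumr exchange_big/=; congr (_ * _).
    apply: eq_bigr => l _; rewrite mulr_suml; apply: eq_bigr => i _.
    rewrite mulrAC; congr (_ * _ * _).
    have := nbhs_singleton G_sym; move=> Gs.
    by rewrite -[in RHS]Gs -trmx_inv !mxE.
  under eq_bigr => l _.
    rewrite (_ : \sum_i _ = (l == j)%:R); last first.
      by have := mulVmx Gu => /matrixP/(_ l j); rewrite !mxE.
    over.
  rewrite (bigD1 j)//= eqxx mul1r big1 ?addr0// => l /negPf ->.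
  by rewrite mul0r.
rewrite /along -/(dX _) derYGZ !innerE -big_split/=.
pose A (W : vfield R n) k :=
  \sum_a \sum_b christoffel G k a b x * X x 0 a * W x 0 b.
pose L a b j := \sum_k christoffel G k a b x * G x k j.
have AG (W V : vfield R n) : \sum_i \sum_j A W i * G x i j * V x 0 j =
    \sum_b \sum_j \sum_a X x 0 a * W x 0 b * V x 0 j * L a b j.
  transitivity (\sum_j \sum_b \sum_a \sum_i
     X x 0 a * W x 0 b * V x 0 j * (christoffel G i a b x * G x i j)).
    rewrite exchange_big/=; apply: eq_bigr => j _.
    under eq_bigr => i _ do rewrite /A exchange_big/= !mulr_suml.
    rewrite exchange_big/=; apply: eq_bigr => b _.
    under eq_bigr => i _ do rewrite !mulr_suml.
    rewrite exchange_big/=; apply: eq_bigr => a _; apply: eq_bigr => i _; ring.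
  rewrite exchange_big/=; apply: eq_bigr => b _; apply: eq_bigr => j _.
  by apply: eq_bigr => a _; rewrite -mulr_sumr.
have nE (W : vfield R n) i : nabla G X W x 0 i = dX (vcomp W i) + A W i.
  by rewrite !mxE.
have GE i j : G x i j = G x j i.
  by rewrite -[in LHS](nbhs_singleton G_sym) mxE.
transitivity (\sum_i \sum_j (dX (vcomp Y i) * G x i j * Z x 0 j
    + Y x 0 i * G x i j * dX (vcomp Z j))
  + (\sum_i \sum_j A Y i * G x i j * Z x 0 j
     + \sum_i \sum_j A Z i * G x i j * Y x 0 j)).
  rewrite !AG [X in _ + (_ + X)]exchange_big/= -!big_split/=.
  apply: eq_bigr => i _; rewrite -!big_split/=; apply: eq_bigr => j _.
  rewrite addrAC; congr (_ + _).
  rewrite dXG mulr_sumr mulr_suml -big_split/=; apply: eq_bigr => a _.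
  rewrite /L !lower (partial_sym a j i).
  by field.
rewrite [X in _ + (_ + X)]exchange_big/= -!big_split/=.
apply: eq_bigr => i _; rewrite -!big_split/=; apply: eq_bigr => j _.
rewrite !nE (GE j i); ring.
Qed.
End LeviCivita.

(** A tensor identity holds on [M] when it holds in components at every point
    of the domain of every local orthonormal frame. *)

Section Global.
Variables (R : realType) (n : nat) (M : smoothManifold R n).
Variables (g : riemannianMetric M) (f : M -> R).

Definition in_local_frames
  (P : ('rV[R]_n -> 'M[R]_n) -> ('I_n -> vfield R n) -> sfield R n ->
       'rV[R]_n -> Prop) : Prop :=
  forall phi, atlas phi ->
  forall U : set 'rV[R]_n, open U -> U `<=` cimage phi ->
  forall E, orthonormal_frame (gram g phi) U E ->
  forall x, U x -> P (gram g phi) E (f \o cinv phi) x.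

Definition div_exp_Riem_zero : Prop := in_local_frames (@div_zero_at R n).

Definition Ric_f_codazzi : Prop := in_local_frames (@codazzi_at R n).

Definition cotton_weyl_condition : Prop :=
  in_local_frames (@cotton_weyl_at R n).

End Global.

(* Main.v *)
Require Import Defs.
From HB Require Import structures.
From mathcomp Require Import all_boot all_order all_algebra.
From mathcomp Require Import all_classical all_reals all_analysis.
From mathcomp Require Import ring lra.

(** The contracted second Bianchi identity [R_ijkl,i = R_jl,k - R_jk,l] and the
    Ricci identity [f_ij,k - f_ik,j = f_t R_tijk] show that both (a) and (b) say
    that [B_ijk := R_ij,k - R_ik,j + f_t R_tijk] vanishes.  Tracing [B_ijk = 0]
    over [i = j], with [R_k = 2 R_ik,i], gives [R_k = 2 f_t R_tk]; and
    [C_ijk + f_t W_tijk - D_ijk] differs from [B_ijk] by a multiple of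
    [(R_k - 2 f_t R_tk) d_ij - (R_j - 2 f_t R_tj) d_ik].

    The tensor calculus is done algebraically, over a commutative ring with
    commuting derivations; it applies to the functions smooth on the open domain
    of the frame, whose partial derivatives are set to [0] off that domain so
    that all identities hold globally. *)

Set Implicit Arguments.
Unset Strict Implicit.
Unset Printing Implicit Defensive.

Import Order.TTheory GRing.Theory Num.Theory.
Import numFieldNormedType.Exports.

Local Open Scope classical_set_scope.
Local Open Scope ring_scope.

(** * Directional derivatives and smooth functions *)

(** [smooth_on] speaks only of coordinate directions: partial derivatives of all orders exist and
    are continuous. The algebra needs two facts from analysis: a derivative along [v] is the
    combination of the partials with the coefficients of [v], and partials commute. Both come from
    the mean value theorem on lines.

    Working in a ring has a price: its elements are total functions, so every hypothesis of the
    algebra, such as [E *m G *m E^T = 1%:M], must hold at all points and not merely on the frame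
    domain. This is why each function is extended by a chosen constant.

    The constant in the comparison of (b) and (c) arises as follows. The term $f_tR_{tk}\delta_{ij}$
    has coefficient $\frac1{n-2}$ in $f_tW_{tijk}$ and $\frac1{(n-1)(n-2)}$ in $D$; the difference
    is $\frac1{n-1}$, which is exactly twice the coefficient $\frac1{2(n-1)}$ of $R_k\delta_{ij}$ in
    the Cotton tensor. *)

Lemma is_deriveP (R : numFieldType) (V W : normedModType R) (f : V -> W)
  (x v : V) (d : W) : is_derive x v f d -> derivable f x v /\ 'D_v f x = d.
Proof. by case. Qed.

Section DirectionalDerivatives.
Variables (R : realType) (V : normedModType R).
Implicit Types (F : V -> R) (x y u v : V).

Lemma derivable_line F x u (h : R) :
  derivable (fun k : R => F (x + k *: u)) h 1 = derivable F (x + h *: u) u.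
Proof.
rewrite /derivable; set g1 := fun k => k^-1 *: _; set g2 := fun k => k^-1 *: _.
suff -> : g1 = g2 by [].
by apply/funext => k; rewrite /g1 /g2 /= [k *: 1]mulr1 scalerDl addrCA.
Qed.

Lemma derive_line F x u (h : R) :
  'D_1 (fun k : R => F (x + k *: u)) h = 'D_u F (x + h *: u).
Proof.
rewrite /derive; set g1 := fun k => k^-1 *: _; set g2 := fun k => k^-1 *: _.
suff -> : g1 = g2 by [].
by apply/funext => k; rewrite /g1 /g2 /= [k *: 1]mulr1 scalerDl addrCA.
Qed.

Lemma derivable_translate F w x u :
  derivable (fun y => F (y + w)) x u = derivable F (x + w) u.
Proof.
rewrite /derivable; set g1 := fun k => k^-1 *: _; set g2 := fun k => k^-1 *: _.
suff -> : g1 = g2 by [].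
by apply/funext => k; rewrite /g1 /g2 /= addrA.
Qed.

Lemma derive_translate F w x u :
  'D_u (fun y => F (y + w)) x = 'D_u F (x + w).
Proof.
rewrite /derive; set g1 := fun k => k^-1 *: _; set g2 := fun k => k^-1 *: _.
suff -> : g1 = g2 by [].
by apply/funext => k; rewrite /g1 /g2 /= addrA.
Qed.

(** The bound by absolute values covers both signs of [t], since difference quotients approach 0
    from either side. *)
Lemma line_mean_value F x u (t : R) :
  (forall s, `|s| <= `|t| -> derivable F (x + s *: u) u) ->
  exists2 s, `|s| <= `|t| & F (x + t *: u) - F x = t * 'D_u F (x + s *: u).
Proof.
move=> dF; pose phi (k : R) := F (x + k *: u).
have dphi (s : R) : `|s| <= `|t| -> is_derive s 1 phi ('D_u F (x + s *: u)).
  move=> st; split; last exact: derive_line.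
  by rewrite derivable_line; exact: dF.
have phi0 : phi 0 = F x by rewrite /phi scale0r addr0.
have mv a b : a <= b -> (forall s, s \in `[a, b] -> `|s| <= `|t|) ->
    exists2 s, `|s| <= `|t| & phi b - phi a = 'D_u F (x + s *: u) * (b - a).
  move=> ab abt.
  have dphi' s : s \in `[a, b] -> is_derive s 1 phi ('D_u F (x + s *: u)).
    by move=> /abt; exact: dphi.
  have [|c cab ->] := MVT_segment ab (fun s s_in => dphi' s (subset_itv_oo_cc
    s_in)).
    by apply: derivable_within_continuous => s /dphi'.
  by exists c => //; exact: abt.
have [t0|/ltW t0] := leP 0 t.
  have [|s st E] := mv 0 t t0.
    by move=> s; rewrite in_itv/= => /andP[s0 st]; rewrite !ger0_norm.
  by exists s => //; rewrite -phi0 [LHS]E subr0 mulrC.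
have [|s st E] := mv t 0 t0.
  by move=> s; rewrite in_itv/= => /andP[st s0]; rewrite !ler0_norm// lerN2.
by exists s => //; rewrite -phi0 -opprB [X in - X]E sub0r mulrN opprK mulrC.
Qed.

Lemma near_parallelogram (P : set V) x u v : (\forall y \near x, P y) ->
  \forall h \near (0 : R), forall r s, `|r| <= `|h| -> `|s| <= `|h| ->
    P (x + r *: v + s *: u).
Proof.
move=> /nbhs_ballP[e /= e0 xeP].
have b0 : 0 < `|v| + `|u| + 1 by rewrite ltr_wpDl// addr_ge0.
near=> h => r s rh sh; apply: xeP; rewrite -ball_normE /= -addrA opprD addNKr
  normrN.
apply: (le_lt_trans (ler_normD _ _)); rewrite !normrZ.
apply: (@le_lt_trans _ _ (`|h| * (`|v| + `|u| + 1))).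
  rewrite mulrDr mulr1 mulrDr; apply: ler_wpDr => //.
  by apply: lerD; apply: ler_wpM2r.
rewrite -ltr_pdivlMr//; near: h.
apply/nbhs_ballP; exists (e / (`|v| + `|u| + 1)) => /=; first exact: divr_gt0.
by move=> h; rewrite -ball_normE /= sub0r normrN.
Unshelve. all: by end_near. Qed.

(** Only the restriction of [F] to one line matters, and for a function of one variable derivability
    already gives differentiability. *)
Lemma is_deriveZ_dir F x u (c d : R) :
  is_derive x u F d -> is_derive x (c *: u) F (c * d).
Proof.
move=> [dF <-]; pose phi (k : R) := F (x + k *: u).
have dphi : differentiable phi 0.
  by apply/derivable1_diffP; rewrite derivable_line scale0r addr0.
have E : (fun h : R => h^-1 *: ((F \o shift x) (h *: (c *: u)) - F x)) =
    (fun h : R => h^-1 *: ((phi \o shift 0) (h *: c) - phi 0)).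
  apply/funext => h /=; rewrite /phi scale0r !addr0 scalerA.
  by rewrite [x + _]addrC.
split; first by rewrite /derivable E; exact: (@diff_derivable _ _ _ phi).
rewrite /derive E -/(derive phi 0 c) deriveE// -[X in 'd phi 0 X]mulr1.
by rewrite -[c * 1]/(c *: 1) linearZ/= -deriveE// derive_line scale0r addr0.
Qed.

(** Existence of both directional derivatives does not give additivity. The path from [x] to
    [x + h *: v] to [x + h *: v + h *: u] does: on its second leg the mean value theorem yields
    ['D_u F] at a nearby point, and continuity of ['D_u F] finishes. *)
Lemma is_deriveD_dir F x u v : (\forall y \near x, derivable F y u) ->
  {for x, continuous (fun y => 'D_u F y)} -> derivable F x v ->
  is_derive x (u + v) F ('D_u F x + 'D_v F x).
Proof.
move=> dFu cFu dFv.
suff H : (fun h : R => h^-1 *: ((F \o shift x) (h *: (u + v)) - F x)) @ 0^' -->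
    'D_u F x + 'D_v F x.
  by split; [apply/cvg_ex; eexists; exact: H | exact: cvg_lim H].
have -> : (fun h : R => h^-1 *: ((F \o shift x) (h *: (u + v)) - F x)) =
    (fun h => h^-1 * (F (x + h *: v + h *: u) - F (x + h *: v))) \+
    (fun h => h^-1 *: ((F \o shift x) (h *: v) - F x)).
  apply/funext => h /=.
  have -> : h *: (u + v) + x = x + h *: v + h *: u.
    by rewrite scalerDr addrC (addrC (h *: u)) addrA.
  by rewrite (addrC (h *: v) x) -[_ *: _]/(_ * _) -[X in _ = _ + X]/(_ * _)
    -mulrDr addrA subrK.
apply: cvgD; last exact: dFv.
apply/cvgrPdist_lt => e e0.
pose P y := derivable F y u /\ `|'D_u F x - 'D_u F y| < e.
have nP : \forall y \near x, P y.
  near=> y; split; first by near: y.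
  by near: y; move/cvgrPdist_lt : cFu; exact.
have box := near_parallelogram u v nP; near=> h.
have h0 : h != 0 by near: h; exact: nbhs_dnbhs_neq.
have boxh r s : `|r| <= `|h| -> `|s| <= `|h| -> P (x + r *: v + s *: u).
  by move: r s; near: h; apply: nbhs_dnbhs.
have [s sh ->] := line_mean_value (fun s sh => (boxh h s (lexx _) sh).1).
by rewrite mulKf//; have [] := boxh h s (lexx _) sh.
Unshelve. all: by end_near. Qed.

(** The mean value theorem is used twice: along [u] for the increment [phi] in the direction [v],
    then along [v] for ['D_u F]. The left-hand side is symmetric in [u] and [v], which is what makes
    it compare the two mixed derivatives. *)
Lemma second_difference F x u v (h : R) :
  (forall r s, `|r| <= `|h| -> `|s| <= `|h| ->
    derivable F (x + r *: v + s *: u) u /\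
    derivable (fun y => 'D_u F y) (x + r *: v + s *: u) v) ->
  exists r s, [/\ `|r| <= `|h|, `|s| <= `|h| &
    F (x + h *: v + h *: u) - F (x + h *: v) - F (x + h *: u) + F x =
    h * (h * 'D_v (fun y => 'D_u F y) (x + r *: v + s *: u))].
Proof.
move=> dF; pose phi y := F (y + h *: v) - F y.
have dphi s : `|s| <= `|h| ->
    is_derive (x + s *: u) u phi ('D_u F (x + h *: v + s *: u) - 'D_u F (x + s
      *: u)).
  move=> sh; apply: is_deriveB; split => //.
  - by rewrite derivable_translate addrAC; exact: (dF h s (lexx _) sh).1.
  - by rewrite derive_translate addrAC.
  - by have := (dF 0 s); rewrite normr0 scale0r addr0 => /(_ (normr_ge0 _)
    sh)[].
have [s sh E] := line_mean_value (fun s sh => (is_deriveP (dphi s sh)).1).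
have [r rh E'] : exists2 r, `|r| <= `|h| &
    'D_u F (x + s *: u + h *: v) - 'D_u F (x + s *: u) =
    h * 'D_v (fun y => 'D_u F y) (x + s *: u + r *: v).
  apply: (line_mean_value (F := fun y => 'D_u F y)) => r rh; rewrite addrAC.
  exact: (dF r s rh sh).2.
exists r, s; split=> //; rewrite [in RHS]addrAC -E' (addrAC x (s *: u)).
rewrite -((is_deriveP (dphi s sh)).2) -E /phi (addrAC x (h *: u)).
by rewrite opprB addrA addrAC; ring.
Qed.

(** Schwarz's theorem. If the mixed derivatives at [x] differed, continuity would keep them apart on
    a small parallelogram, while the common second difference forces a value of one to equal a value
    of the other there. *)
Lemma derive_comm F x u v :
  (\forall y \near x, derivable F y u /\ derivable F y v) ->
  (\forall y \near x, derivable (fun y => 'D_u F y) y v /\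
                      derivable (fun y => 'D_v F y) y u) ->
  {for x, continuous (fun y => 'D_v (fun y => 'D_u F y) y)} ->
  {for x, continuous (fun y => 'D_u (fun y => 'D_v F y) y)} ->
  'D_v (fun y => 'D_u F y) x = 'D_u (fun y => 'D_v F y) x.
Proof.
move=> d1 d2 cvu cuv; apply/eqP; apply: contraT => neq.
set a := 'D_v _ x in neq *; set b := 'D_u _ x in neq *.
(* Half the gap, so that the two strict estimates add up to [|a - b| < |a - b|]. *)
pose e := `|a - b| / 2.
have e0 : 0 < e by rewrite divr_gt0// normr_gt0 subr_eq0.
pose P y := [/\ derivable F y u, derivable F y v, derivable (fun y => 'D_u F y)
  y v,
  derivable (fun y => 'D_v F y) y u &
  `|a - 'D_v (fun y => 'D_u F y) y| < e /\ `|b - 'D_u (fun y => 'D_v F y) y| <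
    e].
have nP : \forall y \near x, P y.
  have [cu cv] := ((cvgrPdist_lt _ _).1 cvu e e0, (cvgrPdist_lt _ _).1 cuv e
    e0).
  apply: filterS (filterI (filterI d1 d2) (filterI cu cv)).
  by move=> y [[[p1 p2] [p3 p4]] [q1 q2]]; exact: And5 p1 p2 p3 p4 (conj q1 q2).
have [h [h0 box]] : exists h : R, h != 0 /\ forall r s, `|r| <= `|h| -> `|s| <=
  `|h| ->
    P (x + r *: v + s *: u).
  apply: (@filter_ex _ (0 : R)^'); near=> h; split.
    by near: h; exact: nbhs_dnbhs_neq.
  by near: h; apply: nbhs_dnbhs; exact: near_parallelogram.
have [r [s [rh sh E]]] := @second_difference F x u v h
  (fun r s rh sh => let: And5 p1 _ p3 _ _ := box r s rh sh in conj p1 p3).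
have [r' [s' [rh' sh' E']]] : exists r s, [/\ `|r| <= `|h|, `|s| <= `|h| &
    F (x + h *: u + h *: v) - F (x + h *: u) - F (x + h *: v) + F x =
    h * (h * 'D_u (fun y => 'D_v F y) (x + r *: u + s *: v))].
  apply: second_difference => r' s' rh' sh'; rewrite addrAC.
  by have [_ p2 _ p4 _] := box s' r' sh' rh'; exact: conj p2 p4.
have EE : 'D_v (fun y => 'D_u F y) (x + r *: v + s *: u) =
    'D_u (fun y => 'D_v F y) (x + r' *: u + s' *: v).
  apply: (mulfI h0); apply: (mulfI h0); apply: (etrans (esym E)); apply: etrans
    E'.
  by rewrite (addrAC x (h *: u)); ring.
have [_ _ _ _ [la _]] := box r s rh sh; have [_ _ _ _ [_ lb]] := box s' r' sh'
  rh'.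
rewrite EE in la; rewrite (addrAC x (s' *: v)) in lb.
set c := 'D_u _ _ in la lb; have : `|a - b| < e + e.
  apply: le_lt_trans (ler_distD c _ _) _; apply: ltrD; first exact: la.
  by rewrite distrC; exact: lb.
by rewrite -splitr ltxx.
Unshelve. all: by end_near. Qed.

End DirectionalDerivatives.

(** * Stability of smoothness under ring operations and exponentials; derivatives in coordinates *)

Section SmoothOn.
Variables (R : realType) (n : nat) (U : set 'rV[R]_n).
Hypothesis U_open : open U.
Implicit Types (F : 'rV[R]_n -> R) (x : 'rV[R]_n) (k : nat).

Lemma near_open (P : set 'rV[R]_n) x :
  (forall y, U y -> P y) -> U x -> \forall y \near x, P y.
Proof. by move=> UP Ux; apply: filterS UP _; exact: open_nbhs_nbhs. Qed.

Lemma Ck_on_continuous k F x : Ck_on k U F -> U x -> {for x, continuous F}.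
Proof. by case: k => [|k] [cF _]; exact: cF. Qed.

Lemma Ck_on_derivable k F x i : Ck_on k.+1 U F -> U x ->
  derivable F x (delta_mx 0 i).
Proof. by case=> _ /(_ i)[dF _] /dF. Qed.

Lemma Ck_on_partial k F i : Ck_on k.+1 U F -> Ck_on k U (partial i F).
Proof. by case=> _ /(_ i)[]. Qed.

Lemma Ck_onW k F : Ck_on k.+1 U F -> Ck_on k U F.
Proof.
elim: k F => [|k IH] F [cF dF]; split => // i.
by have [? ?] := dF i; split => //; exact: IH.
Qed.

Lemma eq_on_partial F F' x i : (forall y, U y -> F y = F' y) -> U x ->
  partial i F x = partial i F' x.
Proof. by move=> FF' Ux; apply: near_eq_derive; exact: near_open. Qed.

Lemma eq_on_Ck_on k F F' : (forall y, U y -> F y = F' y) ->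
  Ck_on k U F -> Ck_on k U F'.
Proof.
elim: k F F' => [|k IH] F F' FF' [cF dF].
all: have nFF' x : U x -> \forall y \near x, F y = F' y by exact: near_open.
all: have cF' x : U x -> {for x, continuous F'}.
1,3: move=> Ux; rewrite /prop_for /continuous_at -FF'//.
1,2: exact: cvg_trans (near_eq_cvg (nFF' x Ux)) (cF x Ux).
  by split.
split; first exact: cF'.
move=> i; have [dFi CkFi] := dF i; split.
  move=> x Ux; apply: near_eq_derivable (dFi x Ux); exact: nFF'.
by apply: IH CkFi => y Uy; exact: eq_on_partial.
Qed.

Lemma eq_on_smooth F F' : (forall y, U y -> F y = F' y) ->
  smooth_on U F -> smooth_on U F'.
Proof. by move=> FF' sF k; exact: eq_on_Ck_on (sF k). Qed.

Lemma Ck_on_cst k (c : R) : Ck_on k U (cst c).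
Proof.
elim: k c => [|k IH] c; (split; first by move=> x _; exact: cst_continuous) =>
  //.
move=> i; split; first by move=> x _; exact: derivable_cst.
by rewrite (_ : partial i _ = cst 0)//; apply/funext => x; exact: derive_cst.
Qed.

Lemma Ck_onD k F F' : Ck_on k U F -> Ck_on k U F' -> Ck_on k U (F + F').
Proof.
elim: k F F' => [|k IH] F F' [cF dF] [cF' dF'];
  (split; first by move=> x Ux; apply: continuousD; [exact: cF|exact: cF']) =>
    //.
move=> i; have [dFi CkFi] := dF i; have [dFi' CkFi'] := dF' i; split.
  by move=> x Ux; apply: derivableD; [exact: dFi|exact: dFi'].
apply: eq_on_Ck_on (IH _ _ CkFi CkFi') => x Ux.
by rewrite /partial deriveD//; [exact: dFi|exact: dFi'].
Qed.

Lemma Ck_onM k F F' : Ck_on k U F -> Ck_on k U F' -> Ck_on k U (F * F').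
Proof.
elim: k F F' => [|k IH] F F' CF CF'; have [[cF dF] [cF' dF']] := (CF, CF');
  (split; first by move=> x Ux; apply: continuousM; [exact: cF|exact: cF']) =>
    //.
move=> i; have [dFi CkFi] := dF i; have [dFi' CkFi'] := dF' i; split.
  by move=> x Ux; apply: derivableM; [exact: dFi|exact: dFi'].
apply: eq_on_Ck_on
  (Ck_onD (IH _ _ (Ck_onW CF) CkFi') (IH _ _ (Ck_onW CF') CkFi)) => x Ux.
by rewrite /partial deriveM//; [exact: dFi|exact: dFi'].
Qed.

(** [F] is only derivable along [v], so the chain rule is applied on the line through [x] in the
    direction [v]. *)
Lemma is_derive_expR_comp F x (v : 'rV[R]_n) : derivable F x v ->
  is_derive x v (expR \o F) (expR (F x) * 'D_v F x).
Proof.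
move=> dF; pose phi (h : R) := F (x + h *: v).
have dphi : derivable phi 0 1 by rewrite derivable_line scale0r addr0.
have dphi1 : is_derive (0 : R) 1 (expR \o phi) (expR (F x) * 'D_v F x).
  have -> : F x = phi 0 by rewrite /phi scale0r addr0.
  have -> : 'D_v F x = 'D_1 phi 0 by rewrite derive_line scale0r addr0.
  split.
    apply/derivable1_diffP; apply: differentiable_comp.
      exact/derivable1_diffP.
    exact/derivable1_diffP/derivable_expR.
  rewrite -derive1E (derive1_comp dphi (@derivable_expR R (phi 0))).
  by rewrite !derive1E (congr1 (fun g => g (phi 0)) (derive_expR R)).
split.
  by have := (is_deriveP dphi1).1; rewrite (derivable_line (expR \o F)) scale0r
    addr0.
by have := (is_deriveP dphi1).2; rewrite (derive_line (expR \o F)) scale0r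
  addr0.
Qed.

Lemma Ck_on_expR k F : Ck_on k U F -> Ck_on k U (expR \o F).
Proof.
elim: k F => [|k IH] F CF; have [cF dF] := CF;
  (split; first by move=> x Ux; apply: continuous_comp;
     [exact: cF|exact: continuous_expR]) => //.
move=> i; have [dFi CkFi] := dF i; split.
  move=> x Ux; exact: (is_deriveP (is_derive_expR_comp (dFi x Ux))).1.
apply: eq_on_Ck_on (Ck_onM (IH _ (Ck_onW CF)) CkFi) => x Ux.
by rewrite /partial (is_deriveP (is_derive_expR_comp (dFi x Ux))).2.
Qed.

Lemma smooth_derivable F x i : smooth_on U F -> U x ->
  derivable F x (delta_mx 0 i).
Proof. by move=> sF; exact: (Ck_on_derivable (sF 1%N)). Qed.

Lemma smooth_continuous F x : smooth_on U F -> U x -> {for x, continuous F}.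
Proof. by move=> sF; exact: (Ck_on_continuous (sF 0%N)). Qed.

Lemma smooth_partial F i : smooth_on U F -> smooth_on U (partial i F).
Proof. by move=> sF k; exact: (Ck_on_partial _ (sF k.+1)). Qed.

(** This identifies [along], a derivative in a variable direction, with the derivation [coord_act].
    Coordinates of [v] are added one at a time; each addition requires continuity only of the
    partial derivative being added. *)
Lemma smooth_is_derive F x (v : 'rV[R]_n) : smooth_on U F -> U x ->
  is_derive x v F (\sum_i v 0 i * partial i F x).
Proof.
move=> sF Ux; rewrite {1}(row_sum_delta v).
elim: (index_enum _) => [|i s IH]; first by rewrite !big_nil; exact: is_derive0.
rewrite !big_cons.
have dF y : U y -> is_derive y (v 0 i *: delta_mx 0 i) F (v 0 i * partial i F
  y).
  move=> Uy; apply: is_deriveZ_dir.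
  by split => //; exact: smooth_derivable.
rewrite -(is_deriveP (dF x Ux)).2 -(is_deriveP (IH)).2.
apply: is_deriveD_dir.
- by apply: near_open Ux => y Uy; exact: (is_deriveP (dF y Uy)).1.
- rewrite /prop_for /continuous_at (is_deriveP (dF x Ux)).2.
  have E : \forall y \near x, v 0 i * partial i F y = 'D_(v 0 i *: delta_mx 0 i)
    F y.
    by apply: near_open Ux => y Uy; rewrite (is_deriveP (dF y Uy)).2.
  apply: cvg_trans (near_eq_cvg E) _.
  apply: cvgM; first exact: cvg_cst.
  exact: smooth_continuous (smooth_partial _ sF) Ux.
- exact: (is_deriveP IH).1.
Qed.

Lemma smooth_partialC F x i j : smooth_on U F -> U x ->
  partial i (partial j F) x = partial j (partial i F) x.
Proof.
move=> sF Ux; apply: derive_comm.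
- by apply: near_open Ux => y Uy; split; exact: smooth_derivable.
- by apply: near_open Ux => y Uy; split;
    apply: smooth_derivable Uy; exact: smooth_partial.
- by apply: smooth_continuous Ux; do 2!apply: smooth_partial.
- by apply: smooth_continuous Ux; do 2!apply: smooth_partial.
Qed.

End SmoothOn.

(** * Connections with an orthonormal frame *)

Lemma addr_idem_eq0 (V : zmodType) (x : V) : x = x + x -> x = 0.
Proof. by move=> /eqP; rewrite -subr_eq subrr eq_sym => /eqP. Qed.

(* The bracket is not part of the data: it is [conn X Y - conn Y X], so that the
   connection is torsion-free by construction. *)
Record connectionWithFrame (A : comNzRingType) (V : lmodType A) (n : nat) :=
  ConnectionWithFrame {
  act : V -> A -> A;
  conn : V -> V -> V;
  ip : V -> V -> A;
  frame : 'I_n -> V;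
  actDl : forall X Y a, act (X + Y) a = act X a + act Y a;
  actZl : forall b X a, act (b *: X) a = b * act X a;
  actDr : forall X a b, act X (a + b) = act X a + act X b;
  actM : forall X a b, act X (a * b) = act X a * b + a * act X b;
  connDl : forall X Y Z, conn (X + Y) Z = conn X Z + conn Y Z;
  connZl : forall b X Z, conn (b *: X) Z = b *: conn X Z;
  connDr : forall X Y Z, conn X (Y + Z) = conn X Y + conn X Z;
  ipC : forall X Y, ip X Y = ip Y X;
  ipDl : forall X Y Z, ip (X + Y) Z = ip X Z + ip Y Z;
  ipZl : forall b X Z, ip (b *: X) Z = b * ip X Z;
  conn_metric : forall X Y Z,
    act X (ip Y Z) = ip (conn X Y) Z + ip Y (conn X Z);
  act_torsion : forall X Y a,
    act (conn X Y - conn Y X) a = act X (act Y a) - act Y (act X a);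
  conn_jacobi : forall X Y Z, let br X Y := conn X Y - conn Y X in
    br (br X Y) Z + br (br Y Z) X + br (br Z X) Y = 0;
  frame_expand : forall X, X = \sum_i ip X (frame i) *: frame i;
  frame_orthonormal : forall i j, ip (frame i) (frame j) = (i == j)%:R }.

(** * Curvature identities of a torsion-free metric connection, proved formally *)

Section MetricConnection.
Variables (A : comNzRingType) (V : lmodType A) (n : nat).
Variable (S : connectionWithFrame V n).
Implicit Types (X Y Z W : V) (a b : A).

Local Notation act := (act S).
Local Notation "'∇'" := (conn S).
Local Notation ip := (ip S).
Local Notation E := (frame S).

Definition br X Y := ∇ X Y - ∇ Y X.

Definition curv X Y Z := ∇ X (∇ Y Z) - ∇ Y (∇ X Z) - ∇ (br X Y) Z.

Definition riem P Q X Y := ip (curv X Y Q) P.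

Definition cov_scalar2 (T : V -> V -> A) Z X Y :=
  act Z (T X Y) - T (∇ Z X) Y - T X (∇ Z Y).

Definition cov_scalar4 (T : V -> V -> V -> V -> A) Z P Q X Y :=
  act Z (T P Q X Y) - T (∇ Z P) Q X Y - T P (∇ Z Q) X Y
  - T P Q (∇ Z X) Y - T P Q X (∇ Z Y).

Definition ric X Y := \sum_j riem X (E j) Y (E j).

Definition scalar_curv := \sum_i ric (E i) (E i).

Definition hess a X Y := act X (act Y a) - act (∇ X Y) a.

Lemma actNl X a : act (- X) a = - act X a.
Proof. by rewrite -scaleN1r actZl mulN1r. Qed.

Lemma actBl X Y a : act (X - Y) a = act X a - act Y a.
Proof. by rewrite actDl actNl. Qed.

Lemma act0r X : act X 0 = 0.
Proof. by apply: addr_idem_eq0; rewrite -actDr addr0. Qed.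

Lemma actNr X a : act X (- a) = - act X a.
Proof. by apply/eqP; rewrite -addr_eq0 -actDr addNr act0r. Qed.

Lemma actBr X a b : act X (a - b) = act X a - act X b.
Proof. by rewrite actDr actNr. Qed.

Lemma act_sumr X (I : finType) (F : I -> A) :
  act X (\sum_i F i) = \sum_i act X (F i).
Proof. exact: (big_morph (act X) (actDr S X) (act0r X)). Qed.

Lemma connNl X Z : ∇ (- X) Z = - ∇ X Z.
Proof. by rewrite -scaleN1r connZl scaleN1r. Qed.

Lemma conn0l Z : ∇ 0 Z = 0.
Proof. by rewrite -(scale0r 0) connZl !scale0r. Qed.

Lemma conn0r X : ∇ X 0 = 0.
Proof. by apply: addr_idem_eq0; rewrite -connDr addr0. Qed.

Lemma connNr X Y : ∇ X (- Y) = - ∇ X Y.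
Proof. by apply/eqP; rewrite -addr_eq0 -connDr addNr conn0r. Qed.

Lemma ipNl X Y : ip (- X) Y = - ip X Y.
Proof. by rewrite -scaleN1r ipZl mulN1r. Qed.

Lemma ip0l X : ip 0 X = 0.
Proof. by rewrite -(scale0r 0) ipZl mul0r. Qed.

Lemma ipDr X Y Z : ip X (Y + Z) = ip X Y + ip X Z.
Proof. by rewrite ipC ipDl !(ipC S _ X). Qed.

Lemma ipZr b X Y : ip X (b *: Y) = b * ip X Y.
Proof. by rewrite ipC ipZl (ipC S Y). Qed.

Definition expandE := (connDl, connNl, connDr, connNr, ipDl, ipNl,
  actBl, actDl, actNl, actBr, actDr, actNr).

Lemma act_frame X a : act X a = \sum_i ip X (E i) * act (E i) a.
Proof.
rewrite {1}(frame_expand S X).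
have act0 : act 0 a = 0 by rewrite -(scale0r 0) actZl mul0r.
rewrite (big_morph (fun Y => act Y a) (id1 := 0) (op1 := +%R)) //; last first.
  by move=> ? ?; rewrite actDl.
by apply: eq_bigr => i _; rewrite actZl.
Qed.

Lemma riem_antisymr P Q X Y : riem P Q X Y = - riem P Q Y X.
Proof. rewrite /riem /curv /br !expandE; ring. Qed.

(** Curvature vanishes on functions: the commutator of [act X] and [act Y] on [ip Q P] is the
    derivative along the bracket. Expanding both sides by [conn_metric] leaves the two curvature
    terms. *)
Lemma riem_antisyml P Q X Y : riem P Q X Y = - riem Q P X Y.
Proof.
apply/eqP; rewrite -subr_eq0 opprK; apply/eqP.
have := act_torsion S X Y (ip Q P).
rewrite !conn_metric !actDr !conn_metric -/(br X Y) /riem /curv !(ipDl, ipNl).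
rewrite !(ipC S _ Q) => H; apply: (addIr (ip (∇ (br X Y) Q) P + ip Q (∇ (br X Y)
  P))).
rewrite (ipC S _ P) in H *; rewrite add0r {2}H; ring.
Qed.

(** Since the bracket is [conn X Y - conn Y X], expanding the Jacobi identity gives minus the cyclic
    sum of curvatures. *)
Lemma riem_bianchi1 P X Y Z : riem P Z X Y + riem P X Y Z + riem P Y Z X = 0.
Proof.
have := congr1 (ip^~ P) (conn_jacobi S X Y Z).
rewrite /riem /curv /br !expandE ip0l => H; rewrite -oppr0 -H; ring.
Qed.

(** Stands in for division by 2: the classical argument for pair symmetry reaches only twice the
    identity. *)
Hypothesis two_reg : forall a, a + a = 0 -> a = 0.

(** The octahedron argument: four instances of the first Bianchi identity, normalised by the two
    antisymmetries, have a signed sum in which everything cancels except twice the difference. *)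
Lemma riem_pair P Q X Y : riem P Q X Y = riem X Y P Q.
Proof.
apply/eqP; rewrite -subr_eq0; apply/eqP/two_reg.
have [l r] := (riem_antisyml, riem_antisymr).
have h1 := riem_bianchi1 P X Y Q.
have h2 : - riem P Q X Y + riem Q X Y P + riem Q Y P X = 0.
  by rewrite -(riem_bianchi1 Q X Y P) (l Q P).
have h3 : riem P X Y Q - riem Q X Y P + riem X Y P Q = 0.
  by rewrite -(riem_bianchi1 X Q Y P) (l X P) (r P X Q) opprK (l X Q); ring.
have h4 : - riem P Y Q X + riem Q Y P X - riem X Y P Q = 0.
  by rewrite -(riem_bianchi1 Y Q X P) (l Y P) (l Y Q) (r Q Y X) opprK (l Y X) ;
    ring.
have combine a1 a2 a3 a4 b : a1 = 0 -> a2 = 0 -> a3 = 0 -> a4 = 0 ->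
    b = a1 - a2 - a3 + a4 -> b = 0.
  by move=> -> -> -> -> ->; ring.
apply: (combine _ _ _ _ _ h1 h2 h3 h4); ring.
Qed.

Lemma riemDl P P' Q X Y : riem (P + P') Q X Y = riem P Q X Y + riem P' Q X Y.
Proof. exact: ipDr. Qed.

Lemma riemZl a P Q X Y : riem (a *: P) Q X Y = a * riem P Q X Y.
Proof. exact: ipZr. Qed.

Section FrameTrace.
Variables (Z : V) (T : V -> V -> A).
Hypothesis TDl : forall X X' Y, T (X + X') Y = T X Y + T X' Y.
Hypothesis TZl : forall a X Y, T (a *: X) Y = a * T X Y.
Hypothesis TDr : forall X Y Y', T X (Y + Y') = T X Y + T X Y'.
Hypothesis TZr : forall a X Y, T X (a *: Y) = a * T X Y.

(* The coefficients <conn Z E_j, E_k> are skew, as <E_j, E_k> is constant. *)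
Lemma conn_frame_trace :
  \sum_j (T (∇ Z (E j)) (E j) + T (E j) (∇ Z (E j))) = 0.
Proof.
pose w j k := ip (∇ Z (E j)) (E k).
have w_skew j k : w j k + w k j = 0.
  rewrite /w (ipC S _ (E j)) -conn_metric frame_orthonormal.
  case: (j == k); last exact: act0r.
  by apply: addr_idem_eq0; have := actM S Z 1 1; rewrite !mulr1 mul1r.
have T0l Y : T 0 Y = 0 by rewrite -(scale0r 0) TZl mul0r.
have T0r X : T X 0 = 0 by rewrite -(scale0r 0) TZr mul0r.
have El j : T (∇ Z (E j)) (E j) = \sum_k w j k * T (E k) (E j).
  rewrite {1}(frame_expand S (∇ Z (E j))).
  rewrite (big_morph (T^~ (E j)) (id1 := 0) (op1 := +%R)) //.
  by apply: eq_bigr => k _; rewrite TZl.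
have Er j : T (E j) (∇ Z (E j)) = \sum_k w j k * T (E j) (E k).
  rewrite {1}(frame_expand S (∇ Z (E j))).
  rewrite (big_morph (T (E j)) (id1 := 0) (op1 := +%R)) //.
  by apply: eq_bigr => k _; rewrite TZr.
under eq_bigr do rewrite El Er.
rewrite big_split /= [X in X + _]exchange_big -big_split /= big1 // => j _.
by rewrite -big_split big1 // => k _; rewrite /= -mulrDl addrC w_skew mul0r.
Qed.

End FrameTrace.

Lemma riemDr P Q X Y Y' : riem P Q X (Y + Y') = riem P Q X Y + riem P Q X Y'.
Proof.
by rewrite riem_pair riem_antisyml riemDl opprD -!riem_antisyml -!(riem_pair P
  Q).
Qed.

Lemma riemZr a P Q X Y : riem P Q X (a *: Y) = a * riem P Q X Y.
Proof.
by rewrite riem_pair riem_antisyml riemZl -mulrN -riem_antisyml -(riem_pair P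
  Q).
Qed.

Lemma riemDm P Q Q' X Y : riem P (Q + Q') X Y = riem P Q X Y + riem P Q' X Y.
Proof. by rewrite riem_antisyml riemDl opprD -!riem_antisyml. Qed.

Lemma riemZm a P Q X Y : riem P (a *: Q) X Y = a * riem P Q X Y.
Proof. by rewrite riem_antisyml riemZl -mulrN -riem_antisyml. Qed.

Lemma ricDl X X' Y : ric (X + X') Y = ric X Y + ric X' Y.
Proof. by rewrite /ric -big_split; apply: eq_bigr => j _; rewrite riemDl. Qed.

Lemma ricZl a X Y : ric (a *: X) Y = a * ric X Y.
Proof. by rewrite /ric mulr_sumr; apply: eq_bigr => j _; rewrite riemZl. Qed.

Lemma ricC X Y : ric X Y = ric Y X.
Proof. by apply: eq_bigr => j _; rewrite riem_pair. Qed.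

(** Covariant differentiation commutes with the trace: the terms that differentiate the frame cancel
    by [conn_frame_trace]. *)
Lemma cov_ric Z X Y : cov_scalar2 ric Z X Y =
  \sum_j cov_scalar4 riem Z X (E j) Y (E j).
Proof.
have H : \sum_j (riem X (∇ Z (E j)) Y (E j) + riem X (E j) Y (∇ Z (E j))) = 0.
  apply: (conn_frame_trace Z (T := fun P Q => riem X P Y Q)) => *.
  - exact: riemDm.
  - exact: riemZm.
  - exact: riemDr.
  - exact: riemZr.
rewrite /cov_scalar2 {1}/ric act_sumr -[LHS]subr0 -[X in _ - X = _]H /ric
  -!sumrB.
by apply: eq_bigr => j _; rewrite /cov_scalar4; ring.
Qed.

Lemma act_scalar_curv Z : act Z scalar_curv = \sum_i cov_scalar2 ric Z (E i) (E
  i).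
Proof.
have H : \sum_i (ric (∇ Z (E i)) (E i) + ric (E i) (∇ Z (E i))) = 0.
  apply: conn_frame_trace => *.
  - exact: ricDl.
  - exact: ricZl.
  - by rewrite ricC ricDl; congr (_ + _); exact: ricC.
  - by rewrite ricC ricZl ricC.
rewrite act_sumr -[LHS]subr0 -[X in _ - X = _]H -!sumrB.
by apply: eq_bigr => i _; rewrite /cov_scalar2; ring.
Qed.

Lemma cov_riem_antisyml Z P Q X Y :
  cov_scalar4 riem Z P Q X Y = - cov_scalar4 riem Z Q P X Y.
Proof.
rewrite /cov_scalar4 !(riem_antisyml _ P) !(riem_antisyml (∇ Z P)) !actNr.
by ring.
Qed.

Lemma cov_riem_antisymr Z P Q X Y :
  cov_scalar4 riem Z P Q X Y = - cov_scalar4 riem Z P Q Y X.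
Proof.
by rewrite /cov_scalar4 !(riem_antisymr _ _ Y) !(riem_antisymr _ _ (∇ Z Y))
  !actNr; ring.
Qed.

(** The Jacobi identity enters as a direction: the field [Q] is differentiated along the vanishing
    cyclic sum of double brackets. Once everything is expanded, the iterated connections cancel
    formally. *)
Lemma riem_bianchi2 P Q X Y Z : cov_scalar4 riem Z P Q X Y +
  cov_scalar4 riem X P Q Y Z + cov_scalar4 riem Y P Q Z X = 0.
Proof.
have := congr1 (fun X => ip (∇ X Q) P) (conn_jacobi S X Y Z).
rewrite /cov_scalar4 /riem !conn_metric /curv /br !expandE.
rewrite conn0l ip0l => H.
apply: (addIr (- 0)); rewrite -{1}H; ring.
Qed.

Lemma div_riem Q X Y : \sum_i cov_scalar4 riem (E i) (E i) Q X Y =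
  cov_scalar2 ric X Q Y - cov_scalar2 ric Y Q X.
Proof.
rewrite !cov_ric -sumrB; apply: eq_bigr => i _.
(* The first slot and the third direction are both [E i]; the antisymmetries then bring the other
   two terms to the form traced in [cov_ric]. *)
have := riem_bianchi2 (E i) Q X Y (E i).
rewrite (cov_riem_antisyml X (E i)) (cov_riem_antisyml Y (E i)).
rewrite (cov_riem_antisymr Y _ _ (E i)) => H.
by rewrite -[RHS]add0r -H; ring.
Qed.

(** The twice contracted Bianchi identity: tracing [div_riem] over [Q] and [Y] produces the
    divergence of [ric] on one side and the derivative of the scalar curvature minus the same
    divergence on the other. *)
Lemma act_scalar_curv_div Z :
  act Z scalar_curv = 2 * \sum_i cov_scalar2 ric (E i) (E i) Z.
Proof.
have : \sum_j \sum_i cov_scalar4 riem (E i) (E i) (E j) Z (E j) =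
  act Z scalar_curv - \sum_j cov_scalar2 ric (E j) (E j) Z.
  by rewrite act_scalar_curv -sumrB; apply: eq_bigr => j _; rewrite div_riem.
rewrite exchange_big /=; under eq_bigr do rewrite -cov_ric.
by move=> H; rewrite -[LHS](subrK (\sum_j cov_scalar2 ric (E j) (E j) Z)) -H;
  ring.
Qed.

Lemma hessC a X Y : hess a X Y = hess a Y X.
Proof.
have := act_torsion S X Y a; rewrite actBl /hess => H.
by rewrite -[RHS]addr0 -(subrr (act (∇ X Y) a - act (∇ Y X) a)) {1}H; ring.
Qed.

Lemma ricci_identity a X Y Z :
  cov_scalar2 (hess a) Z X Y - cov_scalar2 (hess a) Y X Z =
  \sum_t act (E t) a * riem (E t) X Y Z.
Proof.
(* Symmetry of the Hessian makes [act X a] the innermost derivative; [act_torsion] applied to that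
   function removes the third derivatives, and what remains is the curvature acting on [X]. *)
transitivity (- act (curv Z Y X) a).
  rewrite /cov_scalar2 !(hessC _ X) !(hessC _ (∇ _ X)) /hess /curv !actBr.
  have := act_torsion S Z Y (act X a).
  rewrite /br !expandE => /eqP; rewrite -subr_eq0 => /eqP H.
  by apply/eqP; rewrite -subr_eq0 -oppr0 -H; apply/eqP; ring.
rewrite act_frame -sumrN; apply: eq_bigr => t _.
by rewrite riem_antisymr mulrN mulrC.
Qed.

Lemma div_exp_riem u a Q X Y : (forall Z, act Z u = - u * act Z a) ->
  \sum_i cov_scalar4 (fun P Q X Y => u * riem P Q X Y) (E i) (E i) Q X Y =
  u * (cov_scalar2 ric X Q Y - cov_scalar2 ric Y Q X
       + \sum_i act (E i) a * riem (E i) Q Y X).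
Proof.
move=> act_u; rewrite -div_riem -big_split mulr_sumr; apply: eq_bigr => i _ /=.
by rewrite /cov_scalar4 actM act_u (riem_antisymr _ _ Y X); ring.
Qed.

Lemma ric_hess_codazzi a X Y Z
  (T := fun X Y => ric X Y + hess a X Y) :
  cov_scalar2 T Z X Y - cov_scalar2 T Y X Z =
  cov_scalar2 ric Z X Y - cov_scalar2 ric Y X Z +
  \sum_t act (E t) a * riem (E t) X Y Z.
Proof. by rewrite -ricci_identity /cov_scalar2 /T !actDr; ring. Qed.

End MetricConnection.

(** * The Levi-Civita connection over a ring with derivations *)

Section Coordinates.
Variables (A : comNzRingType) (n : nat) (D : 'I_n -> A -> A).
Hypothesis D_add : forall i a b, D i (a + b) = D i a + D i b.
Hypothesis D_mul : forall i a b, D i (a * b) = D i a * b + a * D i b.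
Hypothesis D_comm : forall i j a, D i (D j a) = D j (D i a).
Variables (G E : 'M[A]_n) (half : A).
Hypothesis G_sym : G^T = G.
Hypothesis E_orthonormal : E *m G *m E^T = 1%:M.
Hypothesis half_add : half + half = 1.
Implicit Types (X Y Z : 'rV[A]_n) (a b : A).

Definition coord_act X a := \sum_i X 0 i * D i a.

Definition coord_ip X Y := (X *m G *m Y^T) 0 0.

(** Christoffel symbols of the first kind contracted with [X]. With the index kept low, metric
    compatibility says that this matrix plus its transpose is the derivative of [G], and
    torsion-freeness is [christoffel_mx_sym]; neither involves the inverse metric. *)
Definition christoffel_mx X : 'M[A]_n := \matrix_(j, l) (half *
  \sum_i X 0 i * (D i (G j l) + D j (G i l) - D l (G i j))).

(* [E^T *m E] is the inverse of [G]. *)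
Definition coord_conn X Y :=
  map_mx (coord_act X) Y + Y *m christoffel_mx X *m (E^T *m E).

Lemma mul_gram_inv : E^T *m E *m G = 1%:M.
Proof. by rewrite -mulmxA; apply: mulmx1C. Qed.

Lemma coord_actDl X Y a : coord_act (X + Y) a = coord_act X a + coord_act Y a.
Proof. by rewrite -big_split; apply: eq_bigr => i _; rewrite mxE mulrDl. Qed.

Lemma coord_actZl b X a : coord_act (b *: X) a = b * coord_act X a.
Proof. by rewrite mulr_sumr; apply: eq_bigr => i _; rewrite mxE mulrA. Qed.

Lemma coord_actDr X a b : coord_act X (a + b) = coord_act X a + coord_act X b.
Proof. by rewrite -big_split; apply: eq_bigr => i _; rewrite D_add mulrDr. Qed.

Lemma coord_actM X a b :
  coord_act X (a * b) = coord_act X a * b + a * coord_act X b.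
Proof.
rewrite mulr_suml mulr_sumr -big_split; apply: eq_bigr => i _ /=.
by rewrite D_mul; ring.
Qed.

Lemma coord_act0 X : coord_act X 0 = 0.
Proof. by apply: addr_idem_eq0; rewrite -coord_actDr addr0. Qed.

Lemma coord_actN X a : coord_act X (- a) = - coord_act X a.
Proof. by apply/eqP; rewrite -addr_eq0 -coord_actDr addNr coord_act0. Qed.

Lemma coord_act_sum X (I : finType) (F : I -> A) :
  coord_act X (\sum_i F i) = \sum_i coord_act X (F i).
Proof. exact: (big_morph _ (coord_actDr X) (coord_act0 X)). Qed.

Lemma christoffel_mxD X Y :
  christoffel_mx (X + Y) = christoffel_mx X + christoffel_mx Y.
Proof.
apply/matrixP => j l; rewrite !mxE -mulrDr -big_split; congr (_ * _).
by apply: eq_bigr => i _; rewrite mxE mulrDl.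
Qed.

Lemma christoffel_mxZ b X : christoffel_mx (b *: X) = b *: christoffel_mx X.
Proof.
apply/matrixP => j l; rewrite !mxE [RHS]mulrCA; congr (_ * _).
by rewrite mulr_sumr; apply: eq_bigr => i _; rewrite mxE mulrA.
Qed.

Lemma christoffel_mx_sym X Y : Y *m christoffel_mx X = X *m christoffel_mx Y.
Proof.
have GE i j : G i j = G j i by rewrite -[in LHS]G_sym mxE.
apply/rowP => l; rewrite !mxE.
transitivity (\sum_j \sum_i half * (X 0 i * Y 0 j *
    (D i (G j l) + D j (G i l) - D l (G i j)))).
  apply: eq_bigr => j _; rewrite mxE !mulr_sumr; apply: eq_bigr => i _; ring.
rewrite exchange_big; apply: eq_bigr => i _ /=.
rewrite mxE !mulr_sumr; apply: eq_bigr => j _.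
by rewrite (GE i j); ring.
Qed.

Lemma christoffel_mx_metric X :
  christoffel_mx X + (christoffel_mx X)^T = map_mx (coord_act X) G.
Proof.
have GE i j : G i j = G j i by rewrite -[in LHS]G_sym mxE.
apply/matrixP => j l; rewrite !mxE -mulrDr -big_split /= /coord_act.
rewrite mulr_sumr; apply: eq_bigr => i _.
rewrite (GE l j) (GE i j) (GE i l) -[RHS]mul1r -half_add; ring.
Qed.

Lemma coord_connDl X Y Z : coord_conn (X + Y) Z = coord_conn X Z + coord_conn Y
  Z.
Proof.
rewrite /coord_conn christoffel_mxD mulmxDr mulmxDl addrACA; congr (_ + _).
by apply/rowP => k; rewrite !mxE coord_actDl.
Qed.

Lemma coord_connZl b X Z : coord_conn (b *: X) Z = b *: coord_conn X Z.
Proof.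
rewrite /coord_conn christoffel_mxZ -scalemxAr -scalemxAl scalerDr; congr (_ +
  _).
by apply/rowP => k; rewrite !mxE coord_actZl.
Qed.

Lemma coord_connDr X Y Z : coord_conn X (Y + Z) = coord_conn X Y + coord_conn X
  Z.
Proof.
rewrite /coord_conn !mulmxDl addrACA; congr (_ + _).
by apply/rowP => k; rewrite !mxE coord_actDr.
Qed.

Lemma coord_ipC X Y : coord_ip X Y = coord_ip Y X.
Proof. by rewrite /coord_ip -[in LHS](trmxK (X *m G)) -trmx_mul mxE trmx_mul
  G_sym mulmxA. Qed.

Lemma coord_ipDl X Y Z : coord_ip (X + Y) Z = coord_ip X Z + coord_ip Y Z.
Proof. by rewrite /coord_ip !mulmxDl mxE. Qed.

Lemma coord_ipZl b X Z : coord_ip (b *: X) Z = b * coord_ip X Z.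
Proof. by rewrite /coord_ip -!scalemxAl mxE. Qed.

Lemma coord_act_mulmx X p q r (M : 'M[A]_(p, q)) (N : 'M[A]_(q, r)) :
  map_mx (coord_act X) (M *m N) =
  map_mx (coord_act X) M *m N + M *m map_mx (coord_act X) N.
Proof.
apply/matrixP => i k; rewrite !mxE coord_act_sum -big_split.
by apply: eq_bigr => j _; rewrite coord_actM !mxE.
Qed.

Lemma coord_conn_metric X Y Z : coord_act X (coord_ip Y Z) =
  coord_ip (coord_conn X Y) Z + coord_ip Y (coord_conn X Z).
Proof.
pose K := christoffel_mx X; pose dX p q := @map_mx A A (coord_act X) p q.
transitivity ((dX _ _ Y *m G *m Z^T + Y *m (K + K^T) *m Z^T
  + Y *m G *m (dX _ _ Z)^T) 0 0).
  have -> : coord_act X (coord_ip Y Z) = dX _ _ (Y *m G *m Z^T) 0 0.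
    by rewrite [RHS]mxE.
  rewrite /dX !coord_act_mulmx -christoffel_mx_metric mulmxDl -map_trmx.
  by [].
have GH : G *m (E^T *m E)^T = 1%:M.
  by rewrite -[in LHS]G_sym -trmx_mul mul_gram_inv trmx1.
have ipl : coord_ip (coord_conn X Y) Z =
    (dX _ _ Y *m G *m Z^T + Y *m K *m Z^T) 0 0.
  by rewrite /coord_ip /coord_conn -/K !mulmxDl -(mulmxA (Y *m K)) mul_gram_inv
    mulmx1.
have ipr : coord_ip Y (coord_conn X Z) =
    (Y *m G *m (dX _ _ Z)^T + Y *m K^T *m Z^T) 0 0.
  rewrite /coord_ip /coord_conn -/K raddfD /= mulmxDr trmx_mul (mulmxA (Y *m
    G)).
  by rewrite -(mulmxA Y G (E^T *m E)^T) GH mulmx1 trmx_mul mulmxA.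
by rewrite ipl ipr mulmxDr mulmxDl !mxE; ring.
Qed.

(** The Christoffel part is symmetric and drops out, so torsion and Jacobi rest only on commuting
    partial derivatives. *)
Lemma coord_brE X Y : coord_conn X Y - coord_conn Y X =
  \row_k (coord_act X (Y 0 k) - coord_act Y (X 0 k)).
Proof.
rewrite /coord_conn christoffel_mx_sym opprD addrACA subrr addr0.
by apply/rowP => k; rewrite !mxE.
Qed.

Lemma coord_act_torsion X Y a : coord_act (coord_conn X Y - coord_conn Y X) a =
  coord_act X (coord_act Y a) - coord_act Y (coord_act X a).
Proof.
rewrite coord_brE {1}/coord_act.
have actact U W : coord_act U (coord_act W a) =
    \sum_k coord_act U (W 0 k) * D k a + \sum_k \sum_l W 0 k * U 0 l * D l (D k
      a).
  rewrite {2}/coord_act coord_act_sum -big_split; apply: eq_bigr => k _.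
  rewrite coord_actM; congr (_ + _); rewrite mulr_sumr.
  by apply: eq_bigr => l _; rewrite mulrA.
rewrite !actact [X in _ - (_ + X)]exchange_big /=.
rewrite [X in _ - (_ + X)](_ : _ = \sum_k \sum_l Y 0 k * X 0 l * D l (D k a)).
  rewrite opprD addrACA subrr addr0 -sumrB; apply: eq_bigr => k _; by rewrite
    mxE mulrBl.
by apply: eq_bigr => k _; apply: eq_bigr => l _; rewrite D_comm (mulrC (X 0 l)).
Qed.

Lemma coord_jacobi X Y Z (br := fun X Y => coord_conn X Y - coord_conn Y X) :
  br (br X Y) Z + br (br Y Z) X + br (br Z X) Y = 0.
Proof.
have brE U W k : br U W 0 k = coord_act U (W 0 k) - coord_act W (U 0 k).
  by rewrite /br coord_brE mxE.
have brbr U W P k : br (br U W) P 0 k =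
    coord_act U (coord_act W (P 0 k)) - coord_act W (coord_act U (P 0 k))
    - (coord_act P (coord_act U (W 0 k)) - coord_act P (coord_act W (U 0 k))).
  by rewrite brE /br coord_act_torsion -/(br _ _) brE coord_actDr coord_actN.
apply/rowP => k; rewrite [LHS]mxE [X in X + _]mxE !brbr [RHS]mxE; ring.
Qed.

Lemma coord_frame_expand X : X = \sum_i coord_ip X (row i E) *: row i E.
Proof.
(* A one-sided inverse of a square matrix over a commutative ring is two-sided: orthonormality of
   the rows yields completeness of the frame. *)
have EE : G *m E^T *m E = 1%:M by apply: mulmx1C; rewrite mulmxA.
rewrite -[LHS]mulmx1 -EE mulmxA mulmx_sum_row; apply: eq_bigr => i _.
congr (_ *: _); rewrite /coord_ip mulmxA !mxE.
by apply: eq_bigr => j _; rewrite !mxE.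
Qed.

Lemma coord_frame_orthonormal i j : coord_ip (row i E) (row j E) = (i == j)%:R.
Proof.
have := congr1 (fun M : 'M[A]_n => M i j) E_orthonormal; rewrite [in X in _ = X
  -> _]mxE => <-.
rewrite /coord_ip !mxE; apply: eq_bigr => k _; rewrite !mxE; congr (_ * _).
by apply: eq_bigr => l _; rewrite !mxE.
Qed.

Definition coord_connection : connectionWithFrame 'rV[A]_n n :=
  ConnectionWithFrame coord_actDl coord_actZl coord_actDr coord_actM
    coord_connDl coord_connZl coord_connDr coord_ipC coord_ipDl coord_ipZl
    coord_conn_metric coord_act_torsion coord_jacobi coord_frame_expand
    coord_frame_orthonormal.

End Coordinates.

(** * Smooth functions on an open set *)

Section SmoothRing.
Variables (R : realType) (n : nat) (U : set 'rV[R]_n) (U_open : open U).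

(* The proof of openness is an argument so that the ring structure below can be
   inferred. *)
Definition smooth_pred of open U : {pred 'rV[R]_n -> R} :=
  fun F => `[< smooth_on U F >].

Lemma smooth_pred_subring : subring_closed (smooth_pred U_open).
Proof.
split=> [|F F' /asboolP sF /asboolP sF'|F F' /asboolP sF /asboolP sF'].
- by apply/asboolP => k; exact: Ck_on_cst.
- apply/asboolP => k; rewrite -mulN1r; apply: Ck_onD => //.
  by apply: Ck_onM => //; rewrite (_ : -1 = cst (-1))//; exact: Ck_on_cst.
- by apply/asboolP => k; exact: Ck_onM.
Qed.

HB.instance Definition _ := GRing.isSubringClosed.Build ('rV[R]_n -> R)
  (smooth_pred U_open) smooth_pred_subring.

Record smoothFun := SmoothFun {
  smooth_val :> 'rV[R]_n -> R;
  _ : smooth_val \in smooth_pred U_open }.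

HB.instance Definition _ := [isSub for smooth_val].
HB.instance Definition _ := [Choice of smoothFun by <:].
HB.instance Definition _ := [SubChoice_isSubComNzRing of smoothFun by <:].

Definition eval (x : 'rV[R]_n) (a : smoothFun) : R := a x.

Lemma eval_is_zmod_morphism x : zmod_morphism (eval x).
Proof. by []. Qed.

Lemma eval_is_monoid_morphism x : monoid_morphism (eval x).
Proof. by []. Qed.

HB.instance Definition _ x :=
  GRing.isZmodMorphism.Build smoothFun R (eval x) (eval_is_zmod_morphism x).
HB.instance Definition _ x :=
  GRing.isMonoidMorphism.Build smoothFun R (eval x) (eval_is_monoid_morphism x).

Lemma evalD x a b : eval x (a + b) = eval x a + eval x b.
Proof. by []. Qed.

Lemma evalN x a : eval x (- a) = - eval x a.
Proof. by []. Qed.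

Lemma evalM x a b : eval x (a * b) = eval x a * eval x b.
Proof. by []. Qed.

Lemma eval_sum x (I : finType) (F : I -> smoothFun) :
  eval x (\sum_i F i) = \sum_i eval x (F i).
Proof. exact: raddf_sum. Qed.

Lemma smoothFunP (a b : smoothFun) : (forall x, eval x a = eval x b) -> a = b.
Proof. by move=> ab; apply/val_inj/funext => x; exact: ab. Qed.

Lemma smooth_on_val (a : smoothFun) : smooth_on U a.
Proof. by case: a => F sF; apply/asboolP. Qed.

(** The value off [U] is a parameter because each use needs its own: 0 for derivatives, a Kronecker
    delta for entries of the metric and of the frame. *)
Definition extend (c : R) (F : 'rV[R]_n -> R) : 'rV[R]_n -> R :=
  fun x => if x \in U then F x else c.

Lemma extend_smooth c F : smooth_on U F -> extend c F \in smooth_pred U_open.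
Proof.
move=> sF; apply/asboolP; apply: eq_on_smooth sF => // x Ux.
by rewrite /extend mem_set.
Qed.

Definition lift c F (sF : smooth_on U F) := SmoothFun (extend_smooth c sF).

Lemma liftE c F (sF : smooth_on U F) x : U x -> eval x (lift c sF) = F x.
Proof. by move=> Ux; rewrite /eval /= /extend mem_set. Qed.

Lemma lift_out c F (sF : smooth_on U F) x : ~ U x -> eval x (lift c sF) = c.
Proof. by move=> nUx; rewrite /eval /= /extend memNset. Qed.

Definition pd i (a : smoothFun) : smoothFun :=
  lift 0 (smooth_partial i (smooth_on_val a)).

Lemma pd_add i a b : pd i (a + b) = pd i a + pd i b.
Proof.
apply: smoothFunP => x; rewrite evalD; have [Ux|nUx] := pselect (U x).
  by rewrite !liftE// /partial deriveD//; apply: smooth_derivable Ux; exact: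
    smooth_on_val.
by rewrite !lift_out// addr0.
Qed.

Lemma pd_mul i a b : pd i (a * b) = pd i a * b + a * pd i b.
Proof.
apply: smoothFunP => x; rewrite evalD !evalM.
have [Ux|nUx] := pselect (U x); last by rewrite !lift_out// mul0r mulr0 addr0.
rewrite !liftE// /partial deriveM; last first.
- by apply: smooth_derivable Ux; exact: smooth_on_val.
- by apply: smooth_derivable Ux; exact: smooth_on_val.
by rewrite addrC; congr (_ + _); rewrite mulrC.
Qed.

Lemma pd_comm i j a : pd i (pd j a) = pd j (pd i a).
Proof.
apply: smoothFunP => x; have [Ux|nUx] := pselect (U x); last by rewrite
  !lift_out.
have E k l : eval x (pd k (pd l a)) = partial k (partial l a) x.
  by rewrite liftE//; apply: eq_on_partial Ux => // y Uy; rewrite -[LHS]/(eval y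
    _) liftE.
by rewrite !E; apply: smooth_partialC Ux => //; exact: smooth_on_val.
Qed.

Lemma smoothFun_two_reg (a : smoothFun) : a + a = 0 -> a = 0.
Proof.
move=> /(congr1 (fun b => eval _ b)) a0; apply: smoothFunP => x.
by have /eqP := a0 x; rewrite evalD -mulr2n mulrn_eq0 => /eqP.
Qed.

Lemma const_smooth (c : R) : cst c \in smooth_pred U_open.
Proof. by apply/asboolP => k; exact: Ck_on_cst. Qed.

Definition half : smoothFun := SmoothFun (const_smooth 2^-1).

Lemma half_add : half + half = 1.
Proof.
apply: smoothFunP => x; rewrite evalD; apply: etrans (esym (splitr (1 : R))).
by rewrite mul1r.
Qed.

End SmoothRing.

Arguments eval : simpl never.

(** The pointwise comparison of (c) with the Codazzi defect, with all tensor components taken as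
    free numbers. The terms $f_kR_{ij}$ and the scalar curvature terms of $f_tW_{tijk}$ and $D$
    cancel; $n\ge 3$ makes both denominators nonzero. *)
Lemma cotton_weyl_algebra (R : realType) (n : nat) (df rm : 'I_n -> R)
  (rc : 'I_n -> 'I_n -> R) (s c1 c2 sj sk : R) (i j k : 'I_n) : (3 <= n)%N ->
  c1 - c2 - (2 * (n%:R - 1))^-1 * (sk * (i == j)%:R - sj * (i == k)%:R)
  + \sum_t df t * (rm t - (n%:R - 2)^-1 *
      (rc t j * (i == k)%:R - rc t k * (i == j)%:R
       + rc i k * (t == j)%:R - rc i j * (t == k)%:R)
      + s / ((n%:R - 1) * (n%:R - 2)) *
        ((t == j)%:R * (i == k)%:R - (t == k)%:R * (i == j)%:R))
  - ((n%:R - 2)^-1 * (df k * rc i j - df j * rc i k)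
     + ((n%:R - 1) * (n%:R - 2))^-1 *
       \sum_t df t * (rc t k * (i == j)%:R - rc t j * (i == k)%:R)
     - s / ((n%:R - 1) * (n%:R - 2)) *
       (df k * (i == j)%:R - df j * (i == k)%:R))
  = c1 - c2 + \sum_t df t * rm t - (2 * (n%:R - 1))^-1 *
    ((sk - 2 * \sum_t df t * rc t k) * (i == j)%:R
     - (sj - 2 * \sum_t df t * rc t j) * (i == k)%:R).
Proof.
move=> n3; have n1 : n%:R - 1 != 0 :> R.
  by rewrite subr_eq0 (eqr_nat _ n 1); case: (n) n3 => [|[|]].
have n2 : n%:R - 2 != 0 :> R.
  by rewrite subr_eq0 (eqr_nat _ n 2); case: (n) n3 => [|[|[|]]].
have sum_delta (a : 'I_n -> R) l : \sum_t a t * (t == l)%:R = a l.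
  rewrite (bigD1 l)//= eqxx mulr1 big1 ?addr0// => t /negPf ->.
  by rewrite mulr0.
pose b := s / ((n%:R - 1) * (n%:R - 2)).
(* [c k] and [- c j] collect the coefficients of the sums that a delta in [t] collapses. *)
pose c m := b * (i == m)%:R - (n%:R - 2)^-1 * rc i m.
under [X in _ + X - _ = _]eq_bigr => t _.
  rewrite (_ : _ * _ = df t * rm t
      + - ((n%:R - 2)^-1 * (i == k)%:R) * (df t * rc t j)
      + (n%:R - 2)^-1 * (i == j)%:R * (df t * rc t k)
      + c k * (df t * (t == j)%:R) + - c j * (df t * (t == k)%:R)); last first.
    by rewrite /c /b; ring.
  over.
under [X in ((n%:R - 1) * _)^-1 * X]eq_bigr => t _.
  rewrite (_ : _ * _ = (i == j)%:R * (df t * rc t k)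
      + - (i == k)%:R * (df t * rc t j)); last by ring.
  over.
rewrite !big_split /= -!mulr_sumr !sum_delta /c /b.
move: (\sum_t _) (\sum_t _) (\sum_t _) => sm vj vk.
move: (_ == _)%:R (_ == _)%:R => dij dik.
by field; rewrite n1 n2.
Qed.

(** * Transfer of the algebraic identities to the tensors in a local orthonormal frame *)

Section Transfer.
Variables (R : realType) (n : nat) (U : set 'rV[R]_n) (U_open : open U).
Local Notation A := (smoothFun U_open).
Variables (G : 'rV[R]_n -> 'M[R]_n) (E : 'I_n -> vfield R n).
Hypothesis G_smooth : forall i j, smooth_on U (fun x => G x i j).
Hypothesis G_sym : forall x, U x -> (G x)^T = G x.
Hypothesis E_frame : orthonormal_frame G U E.

(* Outside [U] the metric and the frame are replaced by the standard ones, so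
   that the frame is orthonormal everywhere. *)
Definition lift_gram : 'M[A]_n :=
  \matrix_(i, j) lift U_open (i == j)%:R (G_smooth i j).

Definition lift_frame : 'M[A]_n :=
  \matrix_(i, j) lift U_open (i == j)%:R (E_frame.1 i j).

Lemma map_lift_gram x : map_mx (eval x) lift_gram = if x \in U then G x else
  1%:M.
Proof.
apply/matrixP => i j; rewrite !mxE.
case: ifPn => [/set_mem Ux|/negP nUx]; first by rewrite liftE.
by rewrite lift_out ?mxE// => Ux; apply: nUx; exact: mem_set.
Qed.

Lemma map_lift_frame x :
  map_mx (eval x) lift_frame = if x \in U then \matrix_(i, j) E i x 0 j else
    1%:M.
Proof.
apply/matrixP => i j; rewrite !mxE.
case: ifPn => [/set_mem Ux|/negP nUx]; first by rewrite liftE// mxE.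
by rewrite lift_out ?mxE// => Ux; apply: nUx; exact: mem_set.
Qed.

Lemma map_eval_inj p q (M N : 'M[A]_(p, q)) :
  (forall x, map_mx (eval x) M = map_mx (eval x) N) -> M = N.
Proof.
move=> MN; apply/matrixP => i j; apply: smoothFunP => x.
by have /matrixP/(_ i j) := MN x; rewrite !mxE.
Qed.

Lemma lift_gram_sym : lift_gram^T = lift_gram.
Proof.
apply: map_eval_inj => x; rewrite -map_trmx map_lift_gram.
by case: ifPn => [/set_mem Ux|_]; [exact: G_sym | exact: trmx1].
Qed.

Lemma lift_frame_orthonormal : lift_frame *m lift_gram *m lift_frame^T = 1%:M.
Proof.
apply: map_eval_inj => x; rewrite !map_mxM -map_trmx map_lift_gram
  map_lift_frame map_mx1.
case: ifPn => [/set_mem Ux|_]; last by rewrite trmx1 !mulmx1.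
apply/matrixP => i j; rewrite [RHS]mxE -(E_frame.2 x Ux) /inner !mxE.
apply: eq_bigr => k _; rewrite !mxE; congr (_ * _).
by apply: eq_bigr => l _; rewrite !mxE.
Qed.

Definition lifted_connection : connectionWithFrame 'rV[A]_n n :=
  coord_connection (@pd_add _ _ _ U_open) (@pd_mul _ _ _ U_open)
    (@pd_comm _ _ _ U_open) lift_gram_sym lift_frame_orthonormal
    (half_add U_open).

Local Notation S := lifted_connection.

(** Agreement is required on [U] only, as the concrete fields are arbitrary elsewhere. [rep2] and
    [rep4] relate operators by their effect on all represented fields, because covariant derivatives
    feed tensors with fields such as [nabla G X Y] that are not frame vectors. *)
Definition reps (F : sfield R n) (a : A) := forall x, U x -> F x = eval x a.

Definition repv (X : vfield R n) (Y : 'rV[A]_n) :=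
  forall x, U x -> X x = map_mx (eval x) Y.

Definition rep2 (T : tensor2 R n) (T' : 'rV[A]_n -> 'rV[A]_n -> A) :=
  forall X Y X' Y', repv X X' -> repv Y Y' -> reps (T X Y) (T' X' Y').

Definition rep4 (T : tensor4 R n) T' := forall B C X Y B' C' X' Y',
  repv B B' -> repv C C' -> repv X X' -> repv Y Y' ->
  reps (T B C X Y) (T' B' C' X' Y').

Lemma reps_vcomp X Y k : repv X Y -> reps (vcomp X k) (Y 0 k).
Proof. by move=> XY x Ux; rewrite /vcomp XY// mxE. Qed.

(** [F] and [a] agree on the open set [U], hence have the same germ at [x]; the directional
    derivative of [a] is then expanded in partials. *)
Lemma reps_along X F Y a : repv X Y -> reps F a -> reps (along X F) (act S Y a).
Proof.
move=> XY Fa x Ux; rewrite /along.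
rewrite (near_eq_derive (g := smooth_val a)); last exact: near_open Ux.
rewrite (is_deriveP (smooth_is_derive U_open _ (smooth_on_val a) Ux)).2.
rewrite /= /coord_act eval_sum; apply: eq_bigr => i _.
by rewrite XY// mxE evalM liftE.
Qed.

Lemma repv_frame i : repv (E i) (frame S i).
Proof.
move=> x Ux; apply/rowP => k; rewrite !mxE.
by rewrite liftE.
Qed.

(** The inverse matrix in [christoffel] is polynomial in the frame, so it is represented in the
    ring. *)
Lemma invmx_gram x : U x ->
  invmx (G x) = map_mx (eval x) (lift_frame^T *m lift_frame).
Proof.
move=> Ux; have := congr1 (map_mx (eval x)) (mul_gram_inv
  lift_frame_orthonormal).
rewrite map_mxM map_lift_gram mem_set// map_mx1 => H.
have Gu : G x \in unitmx by case/mulmx1_unit: H.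
by rewrite -[RHS]mulmx1 -(mulmxV Gu) mulmxA H mul1mx.
Qed.

Lemma reps_christoffel k i j : reps (christoffel G k i j)
  (\sum_l half U_open * (pd i (lift_gram j l) + pd j (lift_gram i l)
     - pd l (lift_gram i j)) * (lift_frame^T *m lift_frame) l k).
Proof.
move=> x Ux; have dG p q r : partial p (fun y => G y q r) x =
    eval x (pd p (lift_gram q r)).
  rewrite liftE//; apply: eq_on_partial Ux => // y Uy.
  by rewrite mxE -[RHS]/(eval y _) liftE.
rewrite /christoffel eval_sum mulr_sumr; apply: eq_bigr => l _.
rewrite invmx_gram// !dG !evalM !evalD evalN.
rewrite mxE (_ : (_ *m _) k l = (lift_frame^T *m lift_frame) l k); last first.
  by rewrite -[in LHS](trmxK (_ *m _)) trmx_mul trmxK mxE.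
by rewrite -[eval x (half _)]/(2^-1) mulrAC mulrA.
Qed.

Lemma repv_nabla X Y X' Y' :
  repv X X' -> repv Y Y' -> repv (nabla G X Y) (conn S X' Y').
Proof.
move=> XX' YY' x Ux; apply/rowP => k; rewrite /= /coord_conn.
rewrite [LHS]mxE [RHS]mxE [in RHS]mxE evalD [in RHS]mxE; congr (_ + _).
  exact: (reps_along XX' (reps_vcomp k YY')).
rewrite -mulmxA mxE eval_sum exchange_big; apply: eq_bigr => j _ /=.
rewrite evalM mxE eval_sum mulr_sumr.
transitivity (\sum_i \sum_l eval x (X' 0 i) * eval x (Y' 0 j) *
    eval x (half U_open * (pd i (lift_gram j l) + pd j (lift_gram i l)
     - pd l (lift_gram i j)) * (lift_frame^T *m lift_frame) l k)).
  apply: eq_bigr => i _; rewrite -mulr_sumr -eval_sum -reps_christoffel//.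
  by rewrite XX'// YY'// !mxE; ring.
rewrite exchange_big /=; apply: eq_bigr => l _.
rewrite evalM [christoffel_mx _ _ _ _ _ _]mxE evalM eval_sum !mulr_sumr
  mulr_suml mulr_sumr.
by apply: eq_bigr => i _; rewrite !evalM; ring.
Qed.

Lemma reps_inner X Y X' Y' :
  repv X X' -> repv Y Y' -> reps (inner G X Y) (ip S X' Y').
Proof.
move=> XX' YY' x Ux; rewrite /inner XX'// YY'//=.
rewrite (_ : eval x _ = map_mx (eval x) (X' *m lift_gram *m Y'^T) 0 0); last
  first.
  by rewrite mxE.
by rewrite !map_mxM -map_trmx map_lift_gram mem_set.
Qed.

Lemma repv_lie_bracket X Y X' Y' :
  repv X X' -> repv Y Y' -> repv (lie_bracket X Y) (br S X' Y').
Proof.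
move=> XX' YY' x Ux; rewrite /br /= coord_brE; last exact: lift_gram_sym.
apply/rowP => k; rewrite !mxE -[RHS]/(_ - _).
by rewrite (reps_along XX' (reps_vcomp k YY'))// (reps_along YY' (reps_vcomp k
  XX')).
Qed.

Lemma repv_curvature X Y Z X' Y' Z' : repv X X' -> repv Y Y' -> repv Z Z' ->
  repv (curvature G X Y Z) (curv S X' Y' Z').
Proof.
move=> XX' YY' ZZ' x Ux; rewrite /curvature /curv !map_mxB.
congr (_ - _ - _); apply: repv_nabla => //.
- exact: repv_nabla.
- exact: repv_nabla.
- exact: repv_lie_bracket.
Qed.

Lemma rep4_Riem : rep4 (Riem G) (riem S).
Proof. by move=> *; apply: reps_inner => //; exact: repv_curvature. Qed.

Lemma rep2_cov T T' Z Z' : rep2 T T' -> repv Z Z' ->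
  rep2 (cov2 G T Z) (cov_scalar2 S T' Z').
Proof.
move=> TT' ZZ' X Y X' Y' XX' YY' x Ux.
have nab := repv_nabla ZZ'; rewrite /cov2 /cov_scalar2 !evalD !evalN.
congr (_ - _ - _); first by apply: reps_along => //; exact: TT'.
  by apply: TT' => //; exact: nab.
by apply: TT' => //; exact: nab.
Qed.

Lemma rep4_cov T T' Z Z' : rep4 T T' -> repv Z Z' ->
  rep4 (cov4 G T Z) (cov_scalar4 S T' Z').
Proof.
move=> TT' ZZ' B C X Y B' C' X' Y' BB' CC' XX' YY' x Ux.
have nab := repv_nabla ZZ'; rewrite /cov4 /cov_scalar4 !evalD !evalN.
by congr (_ - _ - _ - _ - _); first apply: reps_along => //;
  apply: TT' => //; exact: nab.
Qed.

Lemma rep2_Ric : rep2 (Ric G E) (ric S).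
Proof.
move=> X Y X' Y' XX' YY' x Ux; rewrite /Ric /ric eval_sum.
by apply: eq_bigr => j _; apply: rep4_Riem => //; exact: repv_frame.
Qed.

Lemma reps_scal : reps (scal G E) (scalar_curv S).
Proof.
move=> x Ux; rewrite /scal /scalar_curv eval_sum.
by apply: eq_bigr => j _; apply: rep2_Ric => //; exact: repv_frame.
Qed.

Lemma rep2_hessian F a : reps F a -> rep2 (hessian G F) (hess S a).
Proof.
move=> Fa X Y X' Y' XX' YY' x Ux; rewrite /hessian /hess evalD evalN.
congr (_ - _); apply: reps_along => //; first exact: reps_along.
exact: repv_nabla.
Qed.

Variable F : 'rV[R]_n -> R.
Hypothesis F_smooth : smooth_on U F.

Let f : A := lift U_open 0 F_smooth.

Lemma reps_lift c H (sH : smooth_on U H) : reps H (lift U_open c sH).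
Proof. by move=> x Ux; rewrite liftE. Qed.

Lemma expN_smooth : smooth_on U (expR \o - F).
Proof.
move=> k; apply: Ck_on_expR => //; rewrite -mulN1r.
by apply: Ck_onM => //; rewrite (_ : -1 = cst (-1))//; exact: Ck_on_cst.
Qed.

Let u : A := lift U_open 0 expN_smooth.

Lemma act_expN Z : act S Z u = - u * act S Z f.
Proof.
have pdu i : pd i u = - u * pd i f.
  apply: smoothFunP => x; rewrite evalM evalN.
  (* Off [U] both derivatives have the default value 0, so the identity holds there as well. *)
  have [Ux|nUx] := pselect (U x); last by rewrite !lift_out// mulr0.
  have eq_lift c H (sH : smooth_on U H) : partial i (lift U_open c sH) x =
    partial i H x.
    by apply: eq_on_partial Ux => // y Uy; rewrite -[LHS]/(eval y _) liftE.
  have dF : derivable F x (delta_mx 0 i) by exact: smooth_derivable Ux.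
  rewrite !liftE// !eq_lift /partial (is_deriveP (is_derive_expR_comp
    (derivableN dF))).2.
  by rewrite deriveN// mulrN mulNr.
rewrite /= /coord_act mulr_sumr; apply: eq_bigr => i _.
by rewrite pdu mulrCA.
Qed.

(** The tensor $B_{ijk}$ through which the three conditions are compared. *)
Definition codazzi_defect i j k x : R :=
  cov2 G (Ric G E) (E k) (E i) (E j) x - cov2 G (Ric G E) (E j) (E i) (E k) x
  + \sum_t along (E t) F x * Riem G (E t) (E i) (E j) (E k) x.

Local Notation two_reg := (@smoothFun_two_reg R n U U_open).
Local Notation e := (frame S).
Let fE := repv_frame.

Lemma reps_cov_frame T T' i j k : rep2 T T' ->
  reps (cov2 G T (E k) (E i) (E j)) (cov_scalar2 S T' (e k) (e i) (e j)).
Proof. by move=> TT'; apply: (rep2_cov TT' (fE k)); exact: fE. Qed.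

Lemma reps_along_frame t : reps (along (E t) F) (act S (e t) f).
Proof. by apply: reps_along; [exact: fE | exact: reps_lift]. Qed.

Lemma reps_along_scal k : reps (along (E k) (scal G E)) (act S (e k)
  (scalar_curv S)).
Proof. by apply: reps_along; [exact: fE | exact: reps_scal]. Qed.

Lemma reps_Riem_frame i j k l :
  reps (Riem G (E i) (E j) (E k) (E l)) (riem S (e i) (e j) (e k) (e l)).
Proof. by apply: rep4_Riem; exact: fE. Qed.

Lemma reps_codazzi_defect i j k : reps (codazzi_defect i j k)
  (cov_scalar2 S (ric S) (e k) (e i) (e j) - cov_scalar2 S (ric S) (e j) (e i)
    (e k)
   + \sum_t act S (e t) f * riem S (e t) (e i) (e j) (e k)).
Proof.
move=> x Ux; rewrite evalD [eval x (_ - _)]evalD evalN [in RHS]eval_sum.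
congr (_ - _ + _); [exact: reps_cov_frame rep2_Ric _ Ux..|].
apply: eq_bigr => t _; rewrite evalM; congr (_ * _).
  exact: reps_along_frame.
exact: reps_Riem_frame.
Qed.

(** The last two indices are exchanged as in [div_exp_riem]; this is harmless, since the conditions
    range over all indices. *)
Lemma div_exp_RiemE j k l x : U x ->
  div_exp_Riem G E F j k l x = expR (- F x) * codazzi_defect j l k x.
Proof.
move=> Ux; have -> : expR (- F x) = eval x u by rewrite liftE.
rewrite /div_exp_Riem.
rewrite reps_codazzi_defect// -evalM -(div_exp_riem two_reg _ _ _ act_expN)
  eval_sum.
apply: eq_bigr => i _; apply: rep4_cov => // B C X Y B' C' X' Y' *.
by move=> y Uy; rewrite evalM liftE//; congr (_ * _); exact: rep4_Riem.
Qed.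

Lemma cov2_Ric_fE i j k x : U x ->
  cov2 G (Ric_f G E F) (E k) (E i) (E j) x - cov2 G (Ric_f G E F) (E j) (E i) (E
    k) x =
  codazzi_defect i j k x.
Proof.
move=> Ux; rewrite reps_codazzi_defect// -ric_hess_codazzi evalD evalN.
have r2 : rep2 (Ric_f G E F) (fun X Y => ric S X Y + hess S f X Y).
  move=> X Y X' Y' XX' YY' y Uy; rewrite evalD /Ric_f.
  by congr (_ + _); [exact: rep2_Ric | exact: (rep2_hessian (reps_lift _
    F_smooth))].
by congr (_ - _); exact: (reps_cov_frame _ _ _ r2).
Qed.

Lemma along_scalE k x : U x ->
  along (E k) (scal G E) x = \sum_i cov2 G (Ric G E) (E k) (E i) (E i) x.
Proof.
move=> Ux; rewrite reps_along_scal// (act_scalar_curv _ two_reg) eval_sum.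
by apply: eq_bigr => i _; rewrite (reps_cov_frame _ _ _ rep2_Ric).
Qed.

Lemma along_scal_divE k x : U x ->
  along (E k) (scal G E) x = 2 * \sum_i cov2 G (Ric G E) (E i) (E i) (E k) x.
Proof.
move=> Ux; rewrite reps_along_scal// (act_scalar_curv_div _ two_reg).
rewrite evalM eval_sum; congr (_ * _).
by apply: eq_bigr => i _; rewrite (reps_cov_frame _ _ _ rep2_Ric).
Qed.

Lemma Riem_traceE t k x : U x ->
  \sum_i Riem G (E t) (E i) (E i) (E k) x = - Ric G E (E t) (E k) x.
Proof.
move=> Ux; rewrite /Ric -sumrN; apply: eq_bigr => i _.
by rewrite !reps_Riem_frame// riem_antisymr.
Qed.

Lemma div_zero_codazzi_at x : U x -> div_zero_at G E F x <-> codazzi_at G E F x.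
Proof.
move=> Ux; split=> [H i j k|H j k l].
  apply/eqP; rewrite -subr_eq0 cov2_Ric_fE//; apply/eqP.
  have /eqP := H i k j; rewrite div_exp_RiemE// mulf_eq0 gt_eqF ?expR_gt0//=.
  by move/eqP.
by rewrite div_exp_RiemE// -cov2_Ric_fE// H subrr mulr0.
Qed.

Let ric_grad k x := \sum_t along (E t) F x * Ric G E (E t) (E k) x.

Lemma cotton_weylE i j k x : (3 <= n)%N ->
  Cotton G E i j k x + \sum_t along (E t) F x * Weyl G E t i j k x
    - Dtensor G E F i j k x =
  codazzi_defect i j k x - (2 * (n%:R - 1))^-1 *
    ((along (E k) (scal G E) x - 2 * ric_grad k x) * (i == j)%:R
     - (along (E j) (scal G E) x - 2 * ric_grad j x) * (i == k)%:R).
Proof.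
move=> n3; exact: (cotton_weyl_algebra (fun t => along (E t) F x)
  (fun t => Riem G (E t) (E i) (E j) (E k) x)
  (fun p q => Ric G E (E p) (E q) x) _ _ _ _ _ _ _ _ n3).
Qed.

Lemma codazzi_cotton_weyl_at x : (3 <= n)%N -> U x ->
  codazzi_at G E F x <-> cotton_weyl_at G E F x.
Proof.
move=> n3 Ux.
have codazziP : codazzi_at G E F x <-> forall i j k, codazzi_defect i j k x = 0.
  split=> H i j k; first by rewrite -cov2_Ric_fE// H subrr.
  by apply/eqP; rewrite -subr_eq0 cov2_Ric_fE// H.
split=> [/codazziP H|[H1 H2]]; last first.
  apply/codazziP => i j k; have := cotton_weylE i j k x n3.
  (* The second equation of (c) removes the correction term, so the first one is exactly the
     vanishing of the defect. *)
  have grad0 l : along (E l) (scal G E) x - 2 * ric_grad l x = 0.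
    by apply/eqP; rewrite subr_eq0; apply/eqP; exact: H2.
  rewrite (H1 i j k) subrr (grad0 j) (grad0 k) !mul0r subr0 mulr0 subr0.
  by move/esym.
have grad0 k : along (E k) (scal G E) x - 2 * ric_grad k x = 0.
  (* Here [d1] is $R_{ii,k}$, [d2] is $R_{ik,i}$, [s] is $R_k$ and [v] is $f_tR_{tk}$. The defect
     traced over $i=j$ gives $d_1-d_2=v$, and the left side is $s/2$. *)
  have arith (d1 d2 s v : R) : d1 - d2 - v = 0 -> s = d1 -> s = 2 * d2 ->
    s - 2 * v = 0 by lra.
  apply: (arith _ _ _ _ _ (along_scalE k Ux) (along_scal_divE k Ux)).
  transitivity (\sum_i codazzi_defect i i k x); last by rewrite big1.
  rewrite [RHS]big_split /= [in RHS]sumrB; congr (_ + _).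
  rewrite [RHS]exchange_big /=.
  rewrite /ric_grad -sumrN; apply: eq_bigr => t _.
  by rewrite -mulr_sumr Riem_traceE// mulrN.
split=> [i j k|k]; last exact: subr0_eq.
apply: subr0_eq; rewrite cotton_weylE// H (grad0 j) (grad0 k).
by rewrite !mul0r subr0 mulr0 subr0.
Qed.

End Transfer.

(** * Restriction to frame domains and the global equivalences *)

Lemma Ck_on_subset (R : realType) (n k : nat) (U U' : set 'rV[R]_n) F :
  U `<=` U' -> Ck_on k U' F -> Ck_on k U F.
Proof.
move=> UU'; elim: k F => [|k IH] F [cF dF]; (split; first by move=> x /UU';
  exact: cF) => //.
move=> i; have [dFi CkFi] := dF i; split; last exact: IH.
by move=> x /UU'; exact: dFi.
Qed.

Theorem lemma4p1 (R : realType) (n : nat) (M : smoothManifold R n)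
  (g : riemannianMetric M) (f : M -> R) :
  (3 <= n)%N -> smooth_function f ->
  (div_exp_Riem_zero g f <-> Ric_f_codazzi g f) /\
  (Ric_f_codazzi g f <-> cotton_weyl_condition g f).
Proof.
move=> n3 sf.
(* The equivalences already hold separately at each point of each frame domain, so the global ones
   follow by quantification. *)
have pointwise phi U E x : atlas phi -> open U -> U `<=` cimage phi ->
    orthonormal_frame (gram g phi) U E -> U x ->
    (div_zero_at (gram g phi) E (f \o cinv phi) x <->
       codazzi_at (gram g phi) E (f \o cinv phi) x) /\
    (codazzi_at (gram g phi) E (f \o cinv phi) x <->
       cotton_weyl_at (gram g phi) E (f \o cinv phi) x).
  move=> phiM oU Uphi oE Ux.
  have sG i j : smooth_on U (fun x => gram g phi x i j).
    by move=> k; apply: Ck_on_subset Uphi _; exact: gram_smooth.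
  have symG y : U y -> (gram g phi y)^T = gram g phi y.
    by move=> /Uphi; exact: gram_sym.
  have sF : smooth_on U (f \o cinv phi).
    by move=> k; apply: Ck_on_subset Uphi _; exact: sf.
  split; first exact: (div_zero_codazzi_at oU sG symG oE sF).
  exact: (codazzi_cotton_weyl_at oU sG symG oE sF).
split; split=> H phi phiM U oU Uphi E oE x Ux;
  have [h1 h2] := pointwise phi U E x phiM oU Uphi oE Ux.
- exact: (h1.1 (H _ phiM _ oU Uphi _ oE _ Ux)).
- exact: (h1.2 (H _ phiM _ oU Uphi _ oE _ Ux)).
- exact: (h2.1 (H _ phiM _ oU Uphi _ oE _ Ux)).
- exact: (h2.2 (H _ phiM _ oU Uphi _ oE _ Ux)).
Qed.
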